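(* The function $\frac{2\log n}{n}$ is a sharp threshold for the property that a fixed vertex is a temporal source. More specifically, let $\varepsilon(n)=\frac{3(\log n)^{0.8}}{n}$. There is $N$ such that for all $n\ge N$, all $p\in[0,1]$ and any fixed vertex $v$ of $\mathcal G\sim\mathcal F_{n,p}$: (i) if $p<\frac{2\log n}{n}-\varepsilon(n)$, then $v$ is not a temporal source with probability at least $1-\frac{5}{\log n}$; (ii) if $p>\frac{2\log n}{n}+\varepsilon(n)$, then $v$ is a temporal source with probability at least $1-\frac{5}{\log n}$.
   Context: A simple temporal graph is a pair $(G,\lambda)$ where $G=(V,E)$ is a finite simple undirected graph and $\lambda:E\to\mathbb R$ assigns a single time label to each edge. A temporal $(u,v)$-path is a path $u=u_0,\dots,u_\ell=v$ in $G$ with $\lambda(u_0u_1)\le\dots\le\lambda(u_{\ell-1}u_\ell)$. A vertex $v$ is a temporal source if every other vertex can be reached from $v$ by a temporal path. For $n\in\mathbb N$ and $p\in[0,1]$, the model $\mathcal F_{n,p}$: draw $G$ from the Erdős–Rényi model $G_{n,p}$ on $n$ labelled vertices and give each edge of $G$ an independent time label uniform in $[0,1]$. $\log$ is the natural logarithm. A property holds a.a.s. if its probability tends to $1$ as $n\to\infty$. A function $p=p(n)$ is a sharp threshold for a property $\mathcal P$ if for every $\varepsilon>0$, a random temporal graph from $\mathcal F_{n,(1-\varepsilon)p}$ a.a.s. does not have $\mathcal P$, while one from $\mathcal F_{n,(1+\varepsilon)p}$ a.a.s. has $\mathcal P$. *)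

(* Defs.v *)
From HB Require Import structures.
From mathcomp Require Import all_boot all_order all_algebra.
From mathcomp Require Import all_classical all_reals all_analysis.
Set Implicit Arguments.
Unset Strict Implicit.
Unset Printing Implicit Defensive.
Import Order.TTheory GRing.Theory Num.Theory.
Import numFieldNormedType.Exports.
Local Open Scope classical_set_scope.
Local Open Scope ring_scope.

(* The labelling of a temporal graph is a function on the edges only: the
   values of [tlabel] outside [tedges] are never used. *)
Record tgraph (R : realType) (V : finType) := TGraph {
  tedges : {set {set V}} ;
  tedges2 : forall e, e \in tedges -> #|e| = 2%N ;
  tlabel : {set V} -> R }.

Section TemporalGraph.
Context {R : realType} {V : finType}.
Implicit Types (g : tgraph R V) (u v : V).

Definition tadj g : rel V := fun u v => [set u; v]%SET \in tedges g.

Definition edge_times g u (p : seq V) : seq R :=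
  pairmap (fun x y => tlabel g [set x; y]%SET) u p.

(* [u :: p] is the sequence of vertices of the path. *)
Definition temporal_path g u v (p : seq V) : Prop :=
  [/\ path (tadj g) u p, uniq (u :: p), last u p = v &
      sorted <=%R (edge_times g u p)].

Definition temporal_source g v : Prop :=
  forall w, w != v -> exists p, temporal_path g v w p.

End TemporalGraph.

Section IidTuple.
Context d (T : measurableType d) (R : realType) (P : probability T R).

Definition cons_pair n (x : T * n.-tuple T) : n.+1.-tuple T :=
  [the n.+1.-tuple T of x.1 :: x.2].

Lemma measurable_cons_pair n : measurable_fun setT (@cons_pair n).
Proof. exact: (measurable_cons measurable_fst measurable_snd). Qed.

HB.instance Definition _ n :=
  @isMeasurableFun.Build _ _ _ _ (@cons_pair n) (@measurable_cons_pair n).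

(* The n-fold product of P: the law of n independent draws from P. *)
Fixpoint iid n : probability (n.-tuple T) R :=
  match n with
  | 0 => \d_([tuple] : 0.-tuple T)
  | m.+1 => distribution (P \x iid m)%E (@cons_pair m)
  end.

Lemma iid_prod n (B : 'I_n -> set T) : (forall i, measurable (B i)) ->
  iid n [set t | forall i, B i (tnth t i)] = (\prod_(i < n) P (B i))%E.
Proof.
elim: n B => [|n IHn] B mB /=.
  rewrite big_ord0 diracE (_ : (_ \in _) = true)//.
  by apply/mem_set => -[].
rewrite big_ord_recl -IHn// /distribution /pushforward.
pose A := [set t : n.-tuple T | forall i, B (lift ord0 i) (tnth t i)].
have mA : measurable A.
  rewrite (_ : A = \bigcap_(i in [set: 'I_n])
      ((fun t : n.-tuple T => tnth t i) @^-1` B (lift ord0 i))); last first.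
    by apply/seteqP; split => t /= h i; [move=> _|]; exact: h.
  apply: fin_bigcap_measurable => // i _.
  by rewrite -[X in measurable X]setTI; exact: measurable_tnth.
rewrite -[RHS]product_measure1E//; congr (_ _).
apply/seteqP; split => -[x t] /= h.
  split => [|i]; first by have := h ord0.
  by have := h (lift ord0 i); rewrite tnthS.
move=> i; case: (unliftP ord0 i) => [j ->|->]; last exact: h.1.
by rewrite tnthS; exact: h.2.
Qed.

End IidTuple.

Section RandomTemporalGraph.
Context (R : realType).

Definition vpair (n : nat) := {e : {set 'I_n} | #|e| == 2%N}.

(* One presence bit and one time label for each of the 'C(n, 2) pairs. *)
Definition sample (n : nat) :=
  (#|{: vpair n}|.-tuple (bool * measurableTypeR R))%type.

(* Presence bits are Bernoulli(p), labels are uniform on [0, 1], and all of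
   them are independent.  For p outside [0, 1], [bernoulli_prob p] is the
   Dirac mass at [false], so that the graph is almost surely empty. *)
Definition Fnp (n : nat) (p : R) : probability (sample n) R :=
  iid (bernoulli_prob p \x uniform_prob (@ltr01 R))%E #|{: vpair n}|.

Definition pair_data n (w : sample n) (e : vpair n) : bool * R :=
  tnth w (enum_rank e).

Definition sample_edges n (w : sample n) : {set {set 'I_n}} :=
  [set val e | e in [set e : vpair n | (pair_data w e).1]%SET]%SET.

Lemma sample_edges2 n (w : sample n) e : e \in sample_edges w -> #|e| = 2%N.
Proof. by case/imsetP => e' _ ->; exact/eqP/(valP e'). Qed.

Definition sample_label n (w : sample n) (e : {set 'I_n}) : R :=
  if insub e is Some e' then (pair_data w e').2 else 0.

Definition sample_tgraph n (w : sample n) : tgraph R 'I_n :=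
  TGraph (@sample_edges2 n w) (sample_label w).

Lemma tadj_measurable n x y :
  measurable_fun setT (fun w : sample n => tadj (sample_tgraph w) x y).
Proof.
rewrite /tadj /= /sample_edges.
case: (boolP (#|[set x; y]%SET| == 2%N)) => [e2|e2]; last first.
  rewrite [X in measurable_fun _ X](_ : _ = cst false)//; apply/funext => w.
  apply/negbTE/negP => /sample_edges2 /eqP; exact/negP.
pose e : vpair n :=
  exist (fun e : {set 'I_n} => #|e| == 2%N) [set x; y]%SET e2.
rewrite [X in measurable_fun _ X](_ : _ = (fun w => (pair_data w e).1)); last first.
  apply/funext => w; apply/imsetP/idP => [[e' + /(@val_inj _ _ _ e e') ->]|we].
    by rewrite inE.
  by exists e; rewrite ?inE.
exact: (measurableT_comp measurable_fst (measurable_tnth _)).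
Qed.

Lemma label_measurable n (e : {set 'I_n}) :
  measurable_fun setT
    (fun w : sample n => tlabel (sample_tgraph w) e : measurableTypeR R).
Proof.
rewrite /= /sample_label; case: insubP => [e' _ _|_]; last exact: measurable_cst.
exact: (measurableT_comp measurable_snd (measurable_tnth _)).
Qed.

Lemma temporal_source_measurable n (v : 'I_n) :
  measurable [set w : sample n | temporal_source (sample_tgraph w) v].
Proof.
have bm (f : sample n -> bool) : measurable_fun setT f ->
    measurable [set w | f w].
  by move=> mf; rewrite -[X in measurable X]setTI; exact: (mf measurableT [set true]).
pose S w p := [set g : sample n | temporal_path (sample_tgraph g) v w p].
have mS w p : measurable (S w p).
  have mP : measurable [set g : sample n | path (tadj (sample_tgraph g)) v p].
    elim: p v {S} => [|y p IH] x /=; first by rewrite [X in measurable X](_ : _ = setT)//;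
      apply/seteqP.
    rewrite [X in measurable X](_ : _ = [set g | tadj (sample_tgraph g) x y] `&`
      [set g | path (tadj (sample_tgraph g)) y p]).
      by apply: measurableI => //; apply: bm; exact: tadj_measurable.
    by apply/seteqP; split=> g /= /andP.
  have mO : measurable
      [set g : sample n | sorted <=%R (edge_times (sample_tgraph g) v p)].
    rewrite /edge_times; case: p {mP S} => [|y p] /=.
      by rewrite [X in measurable X](_ : _ = setT)//; apply/seteqP.
    elim: p v y => [|z p IH] x y /=.
      by rewrite [X in measurable X](_ : _ = setT)//; apply/seteqP.
    rewrite [X in measurable X](_ : _ = [set g | tlabel (sample_tgraph g) [set x; y]%SET <=
        tlabel (sample_tgraph g) [set y; z]%SET] `&`
      [set g | path <=%R (tlabel (sample_tgraph g) [set y; z]%SET)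
        (pairmap (fun x y => tlabel (sample_tgraph g) [set x; y]%SET) z p)]).
      apply: measurableI; last exact: IH.
      rewrite -[X in measurable X]setTI.
      by apply: measurable_fun_le => //; exact: label_measurable.
    by apply/seteqP; split=> g /= /andP.
  have [/andP[up /eqP lp]|h] := boolP (uniq (v :: p) && (last v p == w)).
    rewrite (_ : S w p = [set g | path (tadj (sample_tgraph g)) v p] `&`
      [set g | sorted <=%R (edge_times (sample_tgraph g) v p)]).
      exact: measurableI.
    by apply/seteqP; split=> g /= [] *; split.
  rewrite (_ : S w p = set0)//; apply/seteqP; split=> // g [_ up lp _].
  by move: h; rewrite up lp eqxx.
rewrite [X in measurable X](_ : _ =
    \bigcap_(w in [set w | w != v]) \bigcup_p S w p).
  apply: fin_bigcap_measurable => [|w _]; first exact: finite_finset.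
  by apply: countable_bigcupT_measurable; [exact: countableP|exact: mS].
apply/seteqP; split=> g /= h w wv.
  by have [p hp] := h w wv; exists p.
by have [p _ hp] := h w wv; exists p.
Qed.

Definition Fnp_prob n (p : R) (Q : tgraph R 'I_n -> Prop) : \bar R :=
  Fnp n p [set w | Q (sample_tgraph w)].

Definition aas (p : nat -> R) (Q : forall n, tgraph R 'I_n -> Prop) : Prop :=
  Fnp_prob (p n) (@Q n) @[n --> \oo] --> 1%E.

Definition sharp_threshold (p : nat -> R)
    (Q : forall n, tgraph R 'I_n -> Prop) : Prop :=
  forall eps : R, 0 < eps ->
    aas (fun n => (1 - eps) * p n) (fun n g => ~ Q n g) /\
    aas (fun n => (1 + eps) * p n) Q.

(* [v] fixes a vertex for each n >= 1; there is none for n = 0. *)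
Definition fixed_source (v : forall n, (0 < n)%N -> 'I_n) n
    (g : tgraph R 'I_n) : Prop :=
  exists n0 : (0 < n)%N, temporal_source g (v n n0).

End RandomTemporalGraph.

(* Main.v *)
(** Cut [[0, 1]] into [K] equal slots, with [K] polynomial in [n], and let [L = log n].

    Supercritical case.  Only use edges from the current infected set to its
    complement, one layer per slot.  Revealing only those edges keeps the
    conditional law a product law in which an unused edge appears in the next
    slot with probability at least [p / K], so that [k] infected vertices spread
    at rate at least [k (n - k) p].  The completion time is thus dominated by a
    sum of independent exponentials of these rates, with mean about
    [2 L / (n p)], and Chernoff's bound with a parameter proportional to
    [L ^ (-1/5)] shows that it exceeds [1] with probability
    [exp (- c L ^ (3/5))].

    Subcritical case.  A vertex that is isolated during [[1/2, 1]] must be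
    reached during [[0, 1/2]].  The second moment method provides about
    [n exp (- n p / 2)] such vertices, while counting the time-increasing paths
    of the first half shows that the expected proportion of them that [v] has
    reached is at most about [exp (n p / 2) / n], which tends to [0]. *)
Require Import Defs.
From mathcomp Require Import all_boot all_order all_algebra.
From mathcomp Require Import ring lra zify.
Set Implicit Arguments.
Unset Strict Implicit.
Unset Printing Implicit Defensive.
Import Order.TTheory GRing.Theory Num.Theory.
Local Open Scope ring_scope.

(** * Finite product measures with unnormalised weights *)

Section ProductWeights.
Context {R : realFieldType} {E S : finType}.
Implicit Types (m : E -> S -> R) (x : {ffun E -> S}).

(** The weights are not normalised, so conditioning on a box needs no division: [restr] yields
    product weights again, and the lost probability is recorded in their [mass]. *)
Definition wt m x : R := \prod_e m e (x e).
Definition mass m : R := \prod_e \sum_i m e i.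
Definition Ex m (f : {ffun E -> S} -> R) : R := \sum_x wt m x * f x.
Definition restr m (B : E -> S -> bool) e i : R := m e i * (B e i)%:R.

Lemma Ex1 m : Ex m (fun=> 1) = mass m.
Proof.
rewrite /Ex /mass bigA_distr_bigA /=.
by apply: eq_bigr => x _; rewrite mulr1.
Qed.

Lemma wt_ge0 m x : (forall e i, 0 <= m e i) -> 0 <= wt m x.
Proof. by move=> m0; apply: prodr_ge0 => e _; exact: m0. Qed.

Lemma mass_ge0 m : (forall e i, 0 <= m e i) -> 0 <= mass m.
Proof. by move=> m0; apply: prodr_ge0 => e _; apply: sumr_ge0. Qed.

Lemma le_Ex m f g : (forall e i, 0 <= m e i) -> (forall x, f x <= g x) ->
  Ex m f <= Ex m g.
Proof.
by move=> m0 fg; apply: ler_sum => x _; rewrite ler_wpM2l// wt_ge0.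
Qed.

Lemma eq_Ex m f g : f =1 g -> Ex m f = Ex m g.
Proof. by move=> fg; apply: eq_bigr => x _; rewrite fg. Qed.

Lemma ExD m f g : Ex m (fun x => f x + g x) = Ex m f + Ex m g.
Proof.
by rewrite /Ex -big_split; apply: eq_bigr => x _; rewrite mulrDr.
Qed.

Lemma ExZ m c f : Ex m (fun x => c * f x) = c * Ex m f.
Proof.
by rewrite /Ex big_distrr; apply: eq_bigr => x _; rewrite /= mulrCA.
Qed.

Lemma Ex_sum m (I : Type) (r : seq I) (P : pred I) F :
  Ex m (fun x => \sum_(i <- r | P i) F i x) = \sum_(i <- r | P i) Ex m (F i).
Proof.
rewrite /Ex exchange_big /=; apply: eq_bigr => x _.
by rewrite big_distrr.
Qed.

Lemma wt_restr m B x :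
  wt (restr m B) x = wt m x * [forall e, B e (x e)]%:R.
Proof.
rewrite /wt big_split /=; congr (_ * _).
have [/forallP h|] := boolP [forall e, B e (x e)].
  by rewrite big1// => e _; rewrite h.
rewrite negb_forall => /existsP[e he].
by rewrite (bigD1 e)//= (negbTE he) mul0r.
Qed.

Lemma Ex_restr m B f :
  Ex (restr m B) f = Ex m (fun x => [forall e, B e (x e)]%:R * f x).
Proof. by apply: eq_bigr => x _; rewrite wt_restr mulrA. Qed.

Lemma restr_ge0 m B :
  (forall e i, 0 <= m e i) -> forall e i, 0 <= restr m B e i.
Proof. by move=> m0 e i; rewrite mulr_ge0. Qed.

Lemma restr_le m B e i : (forall e i, 0 <= m e i) -> restr m B e i <= m e i.
Proof.
by move=> m0; rewrite /restr; case: (B e i); rewrite ?mulr1 ?mulr0.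
Qed.

Lemma sum_restr_le m B e : (forall e i, 0 <= m e i) ->
  \sum_i restr m B e i <= \sum_i m e i.
Proof. by move=> m0; apply: ler_sum => i _; exact: restr_le. Qed.

Lemma Ex_forall m B :
  Ex m (fun x => [forall e, B e (x e)]%:R) = mass (restr m B).
Proof.
by rewrite -Ex1 Ex_restr; apply: eq_Ex => x; rewrite mulr1.
Qed.

(** Law of total expectation over the values of [H]: when every level set is a box, each conditional
    law is again a product, which is what allows induction over slots. *)
Lemma Ex_partition m (T : finType) (H : {ffun E -> S} -> T)
    (B : T -> E -> S -> bool) (f : T -> {ffun E -> S} -> R) :
  (forall t x, (H x == t) = [forall e, B t e (x e)]) ->
  Ex m (fun x => f (H x) x) = \sum_t Ex (restr m (B t)) (f t).
Proof.
move=> HB; rewrite /Ex exchange_big /=; apply: eq_bigr => x _.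
rewrite (bigD1 (H x))//= wt_restr -HB eqxx mulr1 big1 ?addr0// => t tH.
by rewrite wt_restr -HB eq_sym (negbTE tH) mulr0 mul0r.
Qed.

End ProductWeights.

(** * Layered spreading through the slots *)

Section Spreading.
Context {n K : nat}.
Implicit Types (A : {set 'I_n}) (F : {set vpair n}) (e : vpair n)
  (x : {ffun vpair n -> 'I_K.+1}).

Lemma vpairP e : exists u w, u != w /\ val e = [set u; w]%SET.
Proof. by case: e => e /= /cards2P[u [w [uw ->]]]; exists u, w. Qed.

Lemma vpair2P (u w : 'I_n) : u != w -> #|[set u; w]%SET| == 2%N.
Proof. by move=> uw; rewrite cards2 uw. Qed.

Definition cut A : {set vpair n} :=
  [set e | (val e :&: A != set0)%SET && ~~ (val e \subset A)]%SET.

Definition hit A (j : nat) x : {set vpair n} :=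
  [set e in cut A | (x e : nat) == j]%SET.

Definition grow A F : {set 'I_n} := (A :|: \bigcup_(e in F) val e)%SET.

(** The infected set is frozen while slot [j] is read, so each slot adds at most one layer of edges,
    and the paths created have strictly increasing slots. *)
Fixpoint run x (d j : nat) A : {set 'I_n} :=
  if d is d'.+1 then run x d' j.+1 (grow A (hit A j x)) else A.

Lemma cutT : cut setT = set0.
Proof. by apply/setP => e; rewrite !inE subsetT andbF. Qed.

Lemma sub_grow A F : A \subset grow A F.
Proof. exact: subsetUl. Qed.

Lemma edge_sub_grow A F e : e \in F -> val e \subset grow A F.
Proof.
by move=> eF; apply: subset_trans (subsetUr _ _); exact: bigcup_sup.
Qed.

Lemma grow0 A : grow A set0 = A.
Proof. by rewrite /grow big_set0 setU0. Qed.

Lemma run_setT x d j : run x d j setT = setT.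
Proof.
elim: d j => //= d IH j.
have -> : hit setT j x = set0.
  by apply/setP => e; rewrite /hit cutT !inE.
by rewrite grow0.
Qed.

Lemma card_grow_hit A j x : hit A j x != set0 ->
  (#|A| < #|grow A (hit A j x)|)%N.
Proof.
case/set0Pn => e eh; apply: proper_card; rewrite properE sub_grow /=.
have := eh; rewrite !inE => /andP[/andP[_ /subsetPn[w we wA]] _].
apply/subsetPn; exists w => //.
exact: (subsetP (edge_sub_grow A eh)).
Qed.

Lemma card_le_order A : (#|A| <= n)%N.
Proof. by rewrite -[X in (_ <= X)%N](card_ord n) max_card. Qed.

(** A pair from [A] times its complement can be recovered from the edge it spans, since only one
    endpoint of that edge lies in [A]. *)
Lemma card_cut A : (#|A| * (n - #|A|) <= #|cut A|)%N.
Proof.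
have -> : (n - #|A|)%N = #|(~: A)%SET|.
  by rewrite [in RHS]cardsCs setCK card_ord.
rewrite -cardsX.
pose g (z : 'I_n * 'I_n) := [set z.1; z.2]%SET.
have ginj : {in setX A (~: A)%SET &, injective g}.
  move=> [a b] [c d] /=; rewrite !inE /= => /andP[aA bA] /andP[cA dA] /setP h.
  have := h a; have := h b; rewrite !inE !eqxx /= orbT.
  have ad : a != d by apply: contraNneq dA => <-.
  have bc : b != c by apply: contraNneq bA => ->.
  by rewrite (negbTE ad) (negbTE bc) /= orbF => /esym/eqP-> /esym/eqP->.
rewrite -(card_in_imset ginj) -(card_imset _ (@val_inj _ _ (vpair n))).
apply: subset_leq_card; apply/subsetP => _ /imsetP[[a b] + ->].
rewrite !inE /= => /andP[aA bA].
have ab : a != b by apply: contraNneq bA => <-.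
pose e : vpair n := Sub [set a; b]%SET (vpair2P ab).
apply/imsetP; exists e; last by rewrite SubK.
rewrite inE SubK; apply/andP; split.
  by apply/set0Pn; exists a; rewrite !inE eqxx aA.
by apply/subsetPn; exists b; rewrite ?inE ?eqxx ?orbT.
Qed.

Context {R : realFieldType}.
(** [f] is a potential in the number of infected vertices: one slot shrinks its expectation by a
    factor [rho], and it stays at least 1, so it dominates the indicator of failure as in Markov's
    inequality. In [f_step], [z] bounds the probability that no cut edge is hit. *)
Variables (f : nat -> R) (q rho : R).
Hypotheses (q01 : 0 <= q <= 1) (rho0 : 0 <= rho).
Hypothesis f_mono : forall i j, (0 < i <= j)%N -> (j <= n)%N -> f j <= f i.
Hypothesis f_ge1 : forall i, (0 < i <= n)%N -> 1 <= f i.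
Hypothesis f_step : forall k, (0 < k < n)%N ->
  let z := (1 - q) ^+ (k * (n - k)) in f k * z + f k.+1 * (1 - z) <= rho * f k.

(* Conditioning on an edge not being hit lowers its total weight but not its
   weights on later slots, so this lower bound is preserved by [hazard_grow]. *)
Definition hazard_ge (m : vpair n -> 'I_K.+1 -> R) (j : nat) A :=
  forall e (i : 'I_K.+1), ~~ (val e \subset A) -> (j <= i < K)%N ->
    q * \sum_k m e k <= m e i.

Definition hit_box A j F e (i : 'I_K.+1) : bool :=
  (e \in F) == ((e \in cut A) && ((i : nat) == j)).

(** Prescribing the whole set of edges hit in one slot is a condition on each edge separately, so
    conditioning on it keeps the weights a product. *)
Lemma hit_boxP A j F x :
  (hit A j x == F) = [forall e, hit_box A j F e (x e)].
Proof.
apply/eqP/forallP => [<- e|h].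
  by rewrite /hit_box inE eqxx.
by apply/setP => e; rewrite inE (eqP (h e)).
Qed.

Lemma hazard_grow m j A F : (forall e i, 0 <= m e i) -> hazard_ge m j A ->
  hazard_ge (restr m (hit_box A j F)) j.+1 (grow A F).
Proof.
move=> m0 hm e i eF /andP[ji iK].
have eA : ~~ (val e \subset A).
  by apply: contra eF => /subset_trans; apply; exact: sub_grow.
(* Edges of [F] lie inside the grown set, so [e] was not hit, and at most its weight at slot [j] was
   removed. *)
have /negbTE eF' : e \notin F by apply: contra eF; exact: edge_sub_grow.
rewrite {2}/restr /hit_box eF' gtn_eqF// andbF eqxx mulr1.
have jiK : (j <= i < K)%N by rewrite ltnW.
apply: le_trans (hm e i eA jiK); apply: ler_wpM2l; first by case/andP: q01.
exact: sum_restr_le.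
Qed.

(** Every cut edge loses at least a fraction [q] of its weight when slot [j] is forbidden; the
    losses multiply over the cut. *)
Lemma mass_no_hit m j A : (forall e i, 0 <= m e i) -> hazard_ge m j A ->
  (j < K)%N ->
  mass (restr m (hit_box A j set0)) <= mass m * (1 - q) ^+ (#|A| * (n - #|A|)).
Proof.
move=> m0 hm jK; have /andP[q0 q1] := q01.
apply: (@le_trans _ _ (mass m * (1 - q) ^+ #|cut A|)); last first.
  apply: ler_wpM2l; first exact: mass_ge0.
  by apply: ler_wiXn2l; [lra|lra|exact: card_cut].
rewrite -prodr_const [in leRHS]big_mkcond /= /mass -big_split /=.
apply: ler_prod => e _; apply/andP; split.
  by apply: sumr_ge0 => i _; exact: restr_ge0.
have [ec|ec] := boolP (e \in cut A); last first.
  by rewrite mulr1; exact: sum_restr_le.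
have jK' : (j < K.+1)%N by rewrite ltnS ltnW.
pose i0 := Ordinal jK'.
rewrite (bigD1 i0)//= (_ : restr _ _ e i0 = 0) ?add0r; last first.
  by rewrite /restr /hit_box in_set0 ec eqxx mulr0.
have eA : ~~ (val e \subset A) by move: ec; rewrite inE => /andP[].
have := hm e i0 eA; rewrite /= leqnn jK => /(_ isT).
rewrite (bigD1 i0)//= => h.
apply: (@le_trans _ _ (\sum_(i | i != i0) m e i)); last lra.
by apply: ler_sum => i ii0; exact: (restr_le (hit_box A j set0)).
Qed.

Lemma run_fail d m j A : (forall e i, 0 <= m e i) -> hazard_ge m j A ->
  (j + d = K)%N -> (0 < #|A|)%N ->
  Ex m (fun x => (run x d j A != setT)%:R) <= mass m * f #|A| * rho ^+ d.
Proof.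
elim: d m j A => [|d IH] m j A m0 hm jd A0.
  have An : (0 < #|A| <= n)%N by rewrite A0 card_le_order.
  rewrite expr0 mulr1 /=.
  apply: (@le_trans _ _ (Ex m (fun=> 1))).
    by apply: le_Ex => // x; case: (_ != _).
  rewrite Ex1 -{1}(mulr1 (mass m)); apply: ler_wpM2l; first exact: mass_ge0.
  exact: f_ge1.
(* A completed spread cannot fail any more; it is set apart because [f_step] requires [k < n]. *)
have [->|AT] := eqVneq A setT.
  rewrite (@eq_Ex _ _ _ _ _ (fun=> 0 * 1)) => [|x]; last first.
    by rewrite run_setT eqxx mul0r.
  rewrite ExZ mul0r !mulr_ge0 ?mass_ge0 ?exprn_ge0//.
  apply: (le_trans ler01); apply: f_ge1.
  by rewrite cardsT card_ord leqnn andbT (leq_trans A0)// card_le_order.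
have An : (#|A| < n)%N.
  rewrite ltn_neqAle card_le_order andbT; apply: contra AT => /eqP An.
  by rewrite eqEcard subsetT cardsT card_ord An leqnn.
have m0F F := restr_ge0 (hit_box A j F) m0.
rewrite (_ : Ex _ _ = \sum_F Ex (restr m (hit_box A j F))
    (fun x => (run x d j.+1 (grow A F) != setT)%:R)); last first.
  exact: (@Ex_partition _ _ _ m _ (hit A j) (hit_box A j)
    (fun F x => (run x d j.+1 (grow A F) != setT)%:R) (hit_boxP A j)).
apply: (@le_trans _ _ (\sum_F Ex (restr m (hit_box A j F))
   (fun x => f #|grow A F| * rho ^+ d))).
  apply: ler_sum => F _; rewrite (@eq_Ex _ _ _ _ (fun=> f #|grow A F| * rho ^+ d)
    (fun=> f #|grow A F| * rho ^+ d * 1)); last by move=> ?; rewrite mulr1.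
  rewrite ExZ Ex1 mulrC mulrA.
  apply: IH => //; [exact: hazard_grow|by rewrite addSnnS|].
  exact: leq_trans A0 (subset_leq_card (sub_grow _ _)).
(* Undo the partition: what remains is the expectation of [f] at the size reached after slot [j]. *)
rewrite -(@Ex_partition _ _ _ m _ (hit A j) (hit_box A j)
    (fun F x => f #|grow A F| * rho ^+ d) (hit_boxP A j)).
(* A hit adds at least one vertex and [f] is nonincreasing, so the new value is at most [f #|A|.+1]
   after a hit and [f #|A|] otherwise. The gap being nonnegative, an upper bound on the probability
   of no hit suffices. *)
pose b x : R := (hit A j x == set0)%:R.
have fn : 0 <= f #|A| - f #|A|.+1 by rewrite subr_ge0 f_mono// A0 leqnSn.
apply: (@le_trans _ _ (rho ^+ d * Ex m (fun x =>
    (f #|A| - f #|A|.+1) * b x + f #|A|.+1 * 1))).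
  rewrite -ExZ; apply: le_Ex => // x; rewrite mulrC ler_wpM2l ?exprn_ge0//.
  rewrite /b; have [->|h0] := eqVneq (hit A j x) set0.
    by rewrite grow0 /= !mulr1 subrK.
  rewrite mulr0 add0r mulr1; apply: f_mono.
    by rewrite ltn0Sn card_grow_hit.
  exact: card_le_order.
rewrite ExD !ExZ Ex1.
have -> : Ex m b = mass (restr m (hit_box A j set0)).
  by rewrite -Ex_forall; apply: eq_Ex => x; rewrite /b hit_boxP.
have jK : (j < K)%N by rewrite -jd addnS ltnS leq_addr.
have hz := mass_no_hit m0 hm jK.
have := f_step (introT andP (conj A0 An)).
set z := (1 - q) ^+ _ in hz * => /= st.
have M0 := mass_ge0 m0.
rewrite exprS [leRHS]mulrA [leRHS]mulrC; apply: ler_wpM2l; first exact: exprn_ge0.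
apply: (@le_trans _ _ (mass m * (f #|A| * z + f #|A|.+1 * (1 - z)))).
  have := ler_wpM2l fn hz; move: (mass _) (mass m) => M M'; lra.
by rewrite -mulrA; apply: ler_wpM2l; rewrite // (mulrC (f _) rho).
Qed.

End Spreading.

(** * Probability that given edges have nondecreasing early slots *)

Section SortedBoxes.
Context {R : realFieldType} {E : finType} {K : nat}.
Variables (h : nat) (q : R).
Hypotheses (hK : (h <= K)%N) (q0 : 0 <= q).
Implicit Types (m : E -> 'I_K.+1 -> R) (x : {ffun E -> 'I_K.+1}).

(** This is [q ^+ l] times the number of nondecreasing sequences of [l] slots in [[a, h)]. *)
Fixpoint sorted_weight l a : R :=
  if l is l'.+1 then \sum_(a <= i < h) q * sorted_weight l' i else 1.

Definition sorted_below (es : seq E) (a : nat) x : bool :=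
  path leq a [seq (x e : nat) | e <- es] && all (fun e => x e < h)%N es.

Lemma sorted_weight_ge0 l a : 0 <= sorted_weight l a.
Proof.
elim: l a => //= l IH a.
by apply: sumr_ge0 => i _; rewrite mulr_ge0.
Qed.

(** Reveal the slot of the first edge: as the edges are distinct, this leaves the weights of the
    others untouched and the induction hypothesis applies from that slot on. *)
Lemma sorted_below_le es m a : uniq es -> (forall e i, 0 <= m e i) ->
  (forall e (i : 'I_K.+1), e \in es -> (i < h)%N -> m e i <= q * \sum_k m e k) ->
  Ex m (fun x => (sorted_below es a x)%:R) <= mass m * sorted_weight (size es) a.
Proof.
elim: es m a => [|e es IH] m a /=.
  move=> _ m0 _; by rewrite mulr1 -Ex1; exact: le_Ex.
move=> /andP[ees ues] m0 hm.
pose B (i : nat) e' (k : 'I_K.+1) := (e' == e) ==> (k == i :> nat).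
have BP i x : [forall e', B i e' (x e')] = (x e == i :> nat).
  apply/forallP/eqP => [/(_ e)|xe e']; first by rewrite /B eqxx => /eqP.
  by apply/implyP => /eqP ->; rewrite xe.
apply: (@le_trans _ _ (\sum_(a <= i < h)
    Ex (restr m (B i)) (fun x => (sorted_below es i x)%:R))).
  under eq_bigr do rewrite Ex_restr.
  rewrite -Ex_sum; apply: le_Ex => // x; rewrite {1}/sorted_below /=.
  have [/andP[/andP[ax pxe] /andP[xh ah]]|_] := boolP (_ && _); last first.
    by apply: sumr_ge0 => i _; rewrite mulr_ge0.
  rewrite (bigD1_seq (x e : nat)) ?mem_index_iota ?ax ?iota_uniq//=.
  rewrite BP eqxx /sorted_below pxe ah mulr1 lerDl.
  by apply: sumr_ge0 => i _; rewrite mulr_ge0.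
rewrite big_distrr /= !big_nat; apply: ler_sum => i /andP[ai ih].
have iK : (i < K.+1)%N by rewrite ltnS (leq_trans (ltnW ih)).
apply: le_trans (IH (restr m (B i)) i ues _ _) _.
- exact: restr_ge0.
- move=> e' k e'es kh; have e'e : (e' == e) = false.
    by apply/negP => /eqP e'e; rewrite -e'e e'es in ees.
  under eq_bigr do rewrite /restr /B e'e mulr1.
  by rewrite /restr /B e'e mulr1; apply: hm; rewrite // inE e'es orbT.
rewrite mulrA; apply: ler_wpM2r; first exact: sorted_weight_ge0.
rewrite /mass (bigD1 e)//= [in leRHS](bigD1 e)//= mulrAC.
apply: ler_pM.
- by apply: sumr_ge0 => k _; exact: restr_ge0.
- by apply: prodr_ge0 => e' _; apply: sumr_ge0 => k _; exact: restr_ge0.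
- rewrite (bigD1 (Ordinal iK))//= big1 ?addr0; last first.
    move=> k ki; rewrite /restr /B eqxx /= (_ : (_ == _) = false) ?mulr0//.
    by apply: contraNF ki => /eqP ki; apply/eqP/val_inj.
  by rewrite /restr /B !eqxx mulr1 mulrC hm// mem_head.
- by apply: ler_prod => e' _; rewrite sum_restr_le// sumr_ge0// => k _; exact: restr_ge0.
Qed.

(** A nondecreasing sequence is a multiset of slots, and in the generating function each of the
    [h - a] slots contributes a geometric series of sum [(1 - c * q)^-1]. *)
Lemma sorted_weight_sum (N : nat) (c : R) a : 0 <= c -> c * q < 1 -> (a <= h)%N ->
  \sum_(l < N) c ^+ l * sorted_weight l a <= (1 - c * q)^-1 ^+ (h - a).
Proof.
move=> c0 cq1; set r := (1 - c * q)^-1.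
have cq0 : 0 <= c * q by rewrite mulr_ge0.
have r1 : 1 <= r by rewrite invr_ge1 ?unitfE; lra.
have rE : r = 1 + c * q * r by rewrite /r; field; lra.
have r0 : 0 <= r by lra.
elim: N a => [|N IH] a ah; first by rewrite big_ord0 exprn_ge0.
rewrite big_ord_recl expr0 mul1r /=.
apply: (@le_trans _ _ (1 + \sum_(a <= i < h) c * q * r ^+ (h - i))).
  rewrite lerD2l; under eq_bigr => l _ do
    rewrite /bump /= add1n exprS big_distrr /=.
  rewrite exchange_big /= !big_nat; apply: ler_sum => i /andP[ai ih].
  apply: le_trans (ler_wpM2l cq0 (IH i (ltnW ih))).
  rewrite big_distrr /=; apply: ler_sum => l _.
  by rewrite le_eqVlt; apply/orP; left; apply/eqP; ring.
(* The powers of [r] solve the recurrence with equality, by [r = 1 + c * q * r]. *)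
move: (subnKC ah); move: (h - a)%N => d; elim: d a {IH ah} => [|d IHd] a ad.
  by rewrite big_geq -?ad ?addn0// addr0 expr0.
have ah : (a < h)%N by rewrite -ad addnS ltnS leq_addr.
rewrite big_ltn// (_ : (h - a)%N = d.+1) ?exprS; last by rewrite -ad addKn.
have := IHd a.+1; rewrite addSnnS => /(_ ad) {}IHd.
have rd : 0 <= r ^+ d by rewrite exprn_ge0.
have rrd : r * r ^+ d = r ^+ d + c * q * (r * r ^+ d) by rewrite {1}rE; ring.
by rewrite [leRHS]rrd addrCA addrC lerD2r.
Qed.

End SortedBoxes.

(** * Edge sequences of simple paths *)

Section PathEdges.
Context {n : nat}.
Implicit Types (u v w : 'I_n) (s : seq 'I_n).

(** [insub] drops degenerate steps from a vertex to itself; a simple path has none. *)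
Definition path_edges u s : seq (vpair n) :=
  pmap insub (pairmap (fun a b => [set a; b]%SET) u s).

Lemma path_edges_cons u w s (uw : u != w) :
  path_edges u (w :: s) = Sub [set u; w]%SET (vpair2P uw) :: path_edges w s.
Proof.
by rewrite /path_edges /= (insubT (fun e : {set 'I_n} => #|e| == 2%N) (vpair2P uw)).
Qed.

Lemma mem_path_edges u s e a : e \in path_edges u s -> a \in val e ->
  a \in u :: s.
Proof.
rewrite mem_pmap_sub; elim: s u => [|w s IH] u //=.
rewrite in_cons => /orP[/eqP -> |/IH h]; first by rewrite !inE orbA => ->.
by move=> /h; rewrite !in_cons => ->; rewrite orbT.
Qed.

Lemma size_path_edges u s : uniq (u :: s) -> size (path_edges u s) = size s.
Proof.
elim: s u => [|w s IH] u //.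
rewrite cons_uniq in_cons negb_or -andbA => /and3P[uw us ws].
by rewrite path_edges_cons /= IH.
Qed.

Lemma uniq_path_edges u s : uniq (u :: s) -> uniq (path_edges u s).
Proof.
elim: s u => [|w s IH] u //.
rewrite cons_uniq => /andP[uws ws].
have uw : u != w by move: uws; rewrite in_cons negb_or => /andP[].
rewrite path_edges_cons /= IH// andbT; apply: contra uws => /mem_path_edges.
by apply; rewrite /= !inE eqxx.
Qed.

End PathEdges.

(** * The law of the slot of one edge *)

Section SlotWeights.
Context {R : realFieldType} {n K : nat}.
Variable p : R.
Hypotheses (p01 : 0 <= p <= 1) (K0 : (0 < K)%N).

Definition slot_weight (e : vpair n) (i : 'I_K.+1) : R :=
  if (i < K)%N then p / K%:R else 1 - p.

Lemma slot_weight_ge0 e i : 0 <= slot_weight e i.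
Proof.
rewrite /slot_weight; have /andP[p0 p1] := p01; case: ifP => _; last lra.
by rewrite divr_ge0//; case/andP: p01.
Qed.

Lemma sum_slot_weight (B : pred nat) e :
  \sum_(i < K.+1) slot_weight e i * (B i)%:R
  = p / K%:R * (\sum_(i < K) (B i))%:R + (1 - p) * (B K)%:R.
Proof.
rewrite big_ord_recr /= /slot_weight ltnn; congr (_ + _).
rewrite natr_sum big_distrr /=; apply: eq_bigr => i _.
by rewrite ltn_ord.
Qed.

Lemma slot_weight_sum1 e : \sum_(i < K.+1) slot_weight e i = 1.
Proof.
have := sum_slot_weight predT e; rewrite sum_nat_const card_ord muln1.
under eq_bigr do rewrite mulr1.
by move=> ->; rewrite mulr1 divfK ?subrKC// pnatr_eq0 -lt0n.
Qed.

Lemma mass_slot_weight : mass slot_weight = 1.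
Proof. by rewrite /mass big1// => e _; exact: slot_weight_sum1. Qed.

End SlotWeights.

(** * Second moment argument for the subcritical case *)

Section NotSource.
Context {R : realFieldType} {n h : nat}.
(** An even number of slots makes time 1/2 a slot boundary. An edge avoids the second half with
    probability [c]; given this, it falls in a fixed early slot with probability [q]. *)
Let K := h.*2.
Variables (p : R) (v : 'I_n).
Let c : R := 1 - p / 2.
Let q : R := p / K%:R / c.
Hypotheses (p01 : 0 <= p <= 1) (h0 : (0 < h)%N) (n1 : (1 < n)%N).
Hypothesis nq : n%:R * q < 1.
Implicit Types (w : 'I_n) (x : {ffun vpair n -> 'I_K.+1}).

Local Notation sw := (@slot_weight R n K p).

Definition late (i : nat) := (h <= i < K)%N.

Definition late_free w (e : vpair n) (i : 'I_K.+1) := (w \in val e) ==> ~~ late i.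

Definition late_isolated w x := [forall e, late_free w e (x e)].

(** A count instead of an event: its expectation splits over the paths, and it is at least 1 once
    [w] is reached early. The tuple [t] holds the interior vertices. *)
Definition early_paths w x : R := \sum_(l < n)
  \sum_(t : l.-tuple 'I_n | uniq (v :: rcons t w))
    (sorted_below h (path_edges v (rcons t w)) 0 x)%:R.

Lemma early_paths_ge1 w x s : uniq (v :: rcons s w) ->
  sorted_below h (path_edges v (rcons s w)) 0 x -> 1 <= early_paths w x.
Proof.
move=> us hs; rewrite /early_paths.
have ls : (size s < n)%N.
  have := card_uniqP us; rewrite /= size_rcons => e.
  by have := max_card (mem (v :: rcons s w)); rewrite e card_ord; apply: leq_trans.
have F0 (l : 'I_n) : 0 <= \sum_(t : l.-tuple 'I_n | uniq (v :: rcons t w))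
    (sorted_below h (path_edges v (rcons t w)) 0 x)%:R :> R by apply: sumr_ge0.
rewrite (bigD1 (Ordinal ls))//= (bigD1 (in_tuple s))//= hs -addrA lerDl.
by apply: addr_ge0; apply: sumr_ge0 => // l _; exact: F0.
Qed.

Let c_gt0 : 0 < c.
Proof. by have /andP[p0 p1] := p01; rewrite /c; lra. Qed.

Let c_le1 : c <= 1.
Proof. by have /andP[p0 p1] := p01; rewrite /c; lra. Qed.

Let q_ge0 : 0 <= q.
Proof. by rewrite !divr_ge0// ?(ltW c_gt0)//; case/andP: p01. Qed.

Let K_gt0 : (0 < K)%N. Proof. by rewrite double_gt0. Qed.

Lemma sum_not_late e (b : bool) :
  \sum_(i < K.+1) sw e i * (b ==> ~~ late i)%:R = c ^+ b.
Proof.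
rewrite (sum_slot_weight p (fun i => b ==> ~~ late i)).
have K0 : K%:R != 0 :> R by rewrite pnatr_eq0 -lt0n K_gt0.
case: b => /=; last first.
  by rewrite sum_nat_const card_ord muln1 divfK// mulr1 subrKC.
rewrite /late ltnn andbF mulr1.
rewrite (_ : (\sum_(i < K) _)%N = h); last first.
  rewrite -(big_mkord xpredT (fun i => nat_of_bool (~~ ((h <= i) && (i < K))%N))).
  rewrite (@big_cat_nat _ _ _ h) //=; last by rewrite /K -addnn leq_addr.
  rewrite (eq_big_nat _ _ (F2 := fun=> 1%N)); last first.
    by move=> i /andP[_ ih]; rewrite leqNgt ih.
  rewrite [X in (_ + X)%N](eq_big_nat _ _ (F2 := fun=> 0%N)); last first.
    by move=> i ->.
  by rewrite !sum_nat_const_nat subn0 muln1 muln0 addn0.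
rewrite /c /K -mul2n natrM; field.
by rewrite pnatr_eq0 -lt0n.
Qed.

Definition iso_prob w : R := c ^+ #|[set e : vpair n | w \in val e]%SET|.

Lemma Ex_late_isolated w : mass (restr sw (late_free w)) = iso_prob w.
Proof.
rewrite /iso_prob -prodr_const big_mkcond; apply: eq_bigr => e _ /=.
by rewrite inE sum_not_late; case: ifP.
Qed.

Lemma iso_prob_gt0 w : 0 < iso_prob w.
Proof. by rewrite exprn_gt0 ?c_gt0. Qed.

(** The edges at [w] are among the [n] sets [[set w; u]], and [c <= 1]. *)
Lemma iso_prob_ge w : c ^+ n <= iso_prob w.
Proof.
apply: ler_wiXn2l; first exact: ltW c_gt0.
  exact: c_le1.
rewrite -(card_imset _ (@val_inj _ _ (vpair n))).
apply: (@leq_trans #|[set [set w; u]%SET | u in 'I_n]%SET|); last first.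
  by rewrite -[X in (_ <= X)%N](card_ord n) leq_imset_card.
apply: subset_leq_card; apply/subsetP => _ /imsetP[e + ->].
rewrite inE; have [a [b [_ ->]]] := vpairP e.
rewrite !inE => /orP[/eqP->|/eqP->]; apply/imsetP; first by exists b.
by exists a => //; rewrite setUC.
Qed.

(** The stars of [w] and [w'] share exactly one edge [e0], which the product of the two
    probabilities counts twice. *)
Lemma Ex_late_isolated2 w w' : w != w' ->
  Ex sw (fun x => (late_isolated w x && late_isolated w' x)%:R)
  = iso_prob w * iso_prob w' / c.
Proof.
move=> ww'; pose B (e : vpair n) (i : 'I_K.+1) :=
    (w \in val e) || (w' \in val e) ==> ~~ late i.
rewrite (@eq_Ex _ _ _ _ _ (fun x => [forall e, B e (x e)]%:R)); last first.
  move=> x; congr (_%:R); congr nat_of_bool.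
  apply/andP/forallP => [[/forallP hw /forallP hw'] e|hB].
    have := hw e; have := hw' e; rewrite /B /late_free.
    by case: (w \in _) => //; case: (w' \in _).
  split; apply/forallP => e; have := hB e; rewrite /B /late_free.
    by case: (w \in _).
  by case: (w' \in _); rewrite ?orbT.
rewrite Ex_forall; apply: (canRL (mulfK (lt0r_neq0 c_gt0))).
pose e0 : vpair n := Sub [set w; w']%SET (vpair2P ww').
rewrite -!Ex_late_isolated /mass -big_split /= mulrC (bigD1 e0)//= [RHS](bigD1 e0)//=.
rewrite !mulrA; congr (_ * _).
  by rewrite !sum_not_late /= !inE !eqxx ?orbT /= expr1.
apply: eq_bigr => e ee0; rewrite !sum_not_late.
case: (boolP (w \in _)) => we; case: (boolP (w' \in _)) => w'e;
  rewrite ?expr0 ?mul1r ?mulr1//.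
case/negP: ee0; apply/eqP/val_inj => /=; apply/esym/eqP.
rewrite eqEcard (eqP (valP e)) cards2 ww' andbT.
by apply/subsetP => a; rewrite !inE => /orP[] /eqP->.
Qed.

(** Conditioning on [late_isolated w] keeps the weights a product and gives each early slot
    conditional probability at most [q], so the sorted path bound applies to each of the at most
    [n ^ l] choices of interior vertices. *)
Lemma Ex_early_paths w : Ex sw (fun x => (late_isolated w x)%:R * early_paths w x)
  <= iso_prob w * ((1 - n%:R * q)^-1 ^+ h / n%:R).
Proof.
have m0 := restr_ge0 (late_free w) (@slot_weight_ge0 R n K p p01).
have hm e (i : 'I_K.+1) : (i < h)%N ->
    restr sw (late_free w) e i <= q * \sum_k restr sw (late_free w) e k.
  move=> ih; rewrite sum_not_late.
  have pK0 : 0 <= p / K%:R by rewrite divr_ge0//; case/andP: p01.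
  apply: (@le_trans _ _ (p / K%:R)).
    rewrite (le_trans (restr_le _ _ _ (@slot_weight_ge0 R n K p p01)))//.
    by rewrite /slot_weight (leq_trans ih)// /K -addnn leq_addr.
  rewrite /q; case: (w \in _).
    by rewrite expr1 divfK// lt0r_neq0 ?c_gt0.
  by rewrite expr0 mulr1 ler_peMr// invf_ge1 ?c_gt0// c_le1.
rewrite (_ : Ex _ _ = Ex (restr sw (late_free w)) (early_paths w)); last first.
  by rewrite Ex_restr.
rewrite /early_paths Ex_sum.
apply: (@le_trans _ _ (\sum_(l < n) iso_prob w * (n%:R ^+ l * sorted_weight h q l.+1 0))).
  apply: ler_sum => l _; rewrite Ex_sum.
  apply: (@le_trans _ _ (\sum_(t : l.-tuple 'I_n)
      iso_prob w * sorted_weight h q l.+1 0)); last first.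
    by rewrite sumr_const card_tuple card_ord -[leLHS]mulr_natl natrX mulrCA.
  rewrite big_mkcond; apply: ler_sum => t _; case: ifP => [us|_]; last first.
    rewrite mulr_ge0 ?(ltW (iso_prob_gt0 w))//.
    exact: sorted_weight_ge0 q_ge0 _ _.
  have := @sorted_below_le R (vpair n) K h q _ q_ge0 (path_edges v (rcons t w))
     (restr sw (late_free w)) 0.
  rewrite Ex_late_isolated size_path_edges// size_rcons size_tuple; apply => //.
  - by rewrite /K -addnn leq_addr.
  - exact: uniq_path_edges.
  - by move=> e i _; exact: hm.
rewrite -big_distrr /= ler_wpM2l ?(ltW (iso_prob_gt0 w))//.
have n0 : 0 < n%:R :> R by rewrite ltr0n (ltnW n1).
rewrite ler_pdivlMr// mulrC.
(* The generating function allows a factor [n] per edge, but a path with [l.+1] edges to a fixed end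
   has only [l] free vertices; hence the division by [n]. Its constant term 1 is dropped. *)
have := @sorted_weight_sum R h q q_ge0 n.+1 n%:R 0 (ltW n0) nq (leq0n h).
rewrite subn0; apply: le_trans; rewrite big_ord_recl expr0 mul1r /= big_distrr /=.
rewrite (_ : \sum_(i < n) _ = \sum_(i < n) n%:R ^+ i.+1 * sorted_weight h q i.+1 0); last first.
  by apply: eq_bigr => i _; rewrite exprS mulrA.
by rewrite lerDr ler01.
Qed.


Let mu : R := \sum_(w | w != v) iso_prob w.

Let mu_ge : (n - 1)%:R * c ^+ n <= mu.
Proof.
have -> : (n - 1)%N = #|[pred w | w != v]|.
  by rewrite cardC1 card_ord subn1.
rewrite mulr_natl -sumr_const; apply: ler_sum => w _.
exact: iso_prob_ge.
Qed.

Let mu_gt0 : 0 < mu.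
Proof.
apply: lt_le_trans mu_ge; rewrite mulr_gt0 ?exprn_gt0 ?c_gt0//.
by rewrite ltr0n subn_gt0.
Qed.

Let Z x : R := \sum_(w | w != v) (late_isolated w x)%:R.

Lemma Ex_isolated_count : Ex sw Z = mu.
Proof.
by rewrite Ex_sum; apply: eq_bigr => w _; rewrite Ex_forall Ex_late_isolated.
Qed.

(** The diagonal gives [mu]. Off the diagonal the shared edge costs a factor [c^-1], and the missing
    diagonal of [mu ^+ 2] is added as slack. *)
Lemma Ex_isolated_count2 : Ex sw (fun x => Z x ^+ 2) <= mu + mu ^+ 2 / c.
Proof.
rewrite (@eq_Ex _ _ _ _ _ (fun x => \sum_(w | w != v) \sum_(w' | w' != v)
    (late_isolated w x && late_isolated w' x)%:R)); last first.
  move=> x; rewrite expr2 /Z big_distrl; apply: eq_bigr => w _ /=.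
  rewrite big_distrr; apply: eq_bigr => w' _ /=.
  by case: late_isolated; case: late_isolated; rewrite /= ?mulr1 ?mulr0.
rewrite Ex_sum expr2 {3}/mu -mulrA [X in _ + X]big_distrl /= -big_split /=.
apply: ler_sum => w wv; rewrite Ex_sum (bigD1 w)//=; apply: lerD.
  rewrite (@eq_Ex _ _ _ _ _ (fun x => (late_isolated w x)%:R)).
    by rewrite Ex_forall Ex_late_isolated.
  by move=> x; rewrite andbb.
rewrite mulrA mulrAC /mu [leRHS]big_distrr /= [leRHS](bigD1 w)//=.
rewrite -[leLHS]add0r lerD//.
  by rewrite !mulr_ge0 ?invr_ge0 ?(ltW c_gt0) ?(ltW (iso_prob_gt0 _)).
apply: ler_sum => w' /andP[_ w'w]; rewrite Ex_late_isolated2 1?eq_sym//.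
by rewrite mulrAC.
Qed.

(** On [Q] every late-isolated vertex is reached early, so their number [Z] is at most the path
    count [Y]. But [Z] concentrates around [mu], while [Y] has mean at most [eta * mu]. *)
Lemma source_late_bound (Q : pred {ffun vpair n -> 'I_K.+1}) :
  (forall x w, Q x -> w != v -> late_isolated w x -> exists s,
    uniq (v :: rcons s w) /\ sorted_below h (path_edges v (rcons s w)) 0 x) ->
  Ex sw (fun x => (Q x)%:R) <=
    4 * (((n - 1)%:R * c ^+ n)^-1 + c^-1 - 1) +
    2 * ((1 - n%:R * q)^-1 ^+ h / n%:R).
Proof.
move=> HQ; set eta := _ / n%:R.
pose Y x : R := \sum_(w | w != v) (late_isolated w x)%:R * early_paths w x.
have mu0 := mu_gt0.
have EY : Ex sw Y <= eta * mu.
  rewrite Ex_sum mulrC /mu big_distrl /=; apply: ler_sum => w _.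
  exact: Ex_early_paths.
have Y0 x : 0 <= Y x.
  apply: sumr_ge0 => w _; apply: mulr_ge0 => //.
  by apply: sumr_ge0 => l _; exact: sumr_ge0.
have QY x : Q x -> Z x <= Y x.
  move=> Qx; apply: ler_sum => w wv; case: (boolP (late_isolated _ _)) => iw.
    have [s [us ss]] := HQ x w Qx wv iw.
    by rewrite mul1r; exact: early_paths_ge1 us ss.
  by rewrite mul0r.
(* Chebyshev for [Z] when [Z <= mu / 2], Markov for [Y >= Z] otherwise. *)
have bound x : (Q x)%:R <= 4 * (mu ^- 2 * (Z x ^+ 2) + (- 2 / mu * Z x + 1 * 1))
    + 2 / mu * Y x.
  have -> : 4 * (mu ^- 2 * (Z x ^+ 2) + (- 2 / mu * Z x + 1 * 1)) + 2 / mu * Y x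
      = (2 * (Z x / mu - 1)) ^+ 2 + 2 * (Y x / mu).
    by field; exact: lt0r_neq0.
  have Ym : 0 <= Y x / mu by rewrite divr_ge0// ltW.
  have S0 := sqr_ge0 (2 * (Z x / mu - 1)).
  case: (boolP (Q x)) => Qx; last by rewrite addr_ge0// mulr_ge0.
  have : Z x / mu <= Y x / mu by rewrite ler_pM2r ?invr_gt0// QY.
  move: (Z x / mu) (Y x / mu) Ym S0 => z y y0 S0 zy.
  have [zh|zh] := leP (1 / 2) z; first by rewrite /=; lra.
  by rewrite /=; nra.
apply: (le_trans (le_Ex (@slot_weight_ge0 R n K p p01) bound)).
rewrite ExD !ExZ !ExD !ExZ Ex1 mass_slot_weight ?K_gt0//.
rewrite Ex_isolated_count; apply: lerD.
  apply: ler_wpM2l => //.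
  have e2 : mu ^- 2 * Ex sw (fun x => Z x ^+ 2) <= mu^-1 + c^-1.
    have -> : mu^-1 + c^-1 = mu ^- 2 * (mu + mu ^+ 2 / c).
      by field; rewrite !lt0r_neq0 ?c_gt0.
    by rewrite ler_wpM2l ?invr_ge0 ?sqr_ge0// Ex_isolated_count2.
  have e1 : mu^-1 <= ((n - 1)%:R * c ^+ n)^-1.
    rewrite lef_pV2 ?mu_ge// posrE// mulr_gt0 ?exprn_gt0 ?c_gt0//.
    by rewrite ltr0n subn_gt0.
  have -> : - 2 / mu * mu + 1 * 1 = -1 :> R by field; exact: lt0r_neq0.
  lra.
rewrite -mulrA ler_wpM2l// mulrC ler_pdivrMr//.
Qed.

End NotSource.

From mathcomp Require Import all_classical all_reals all_analysis.
Import numFieldNormedType.Exports.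
Local Open Scope classical_set_scope.
Local Open Scope ring_scope.

(** * From continuous labels to slots *)

Section Discretization.
Context {R : realType} (K : nat).
Hypothesis K0 : (0 < K)%N.

(* Slot [i < K] collects the labels in [[i / K, (i + 1) / K)]; labels outside
   [[0, 1)] go to the first or the last slot, and [K] codes an absent edge. *)
Definition slot (d : bool * R) : 'I_K.+1 :=
  if d.1 then inord (minn K.-1 (Num.truncn (d.2 * K%:R))) else ord_max.

Lemma slot_trueE t : (slot (true, t) : nat) = minn K.-1 (Num.truncn (t * K%:R)).
Proof.
by rewrite /slot /= inordK// ltnS (leq_trans (geq_minl _ _))// leq_pred.
Qed.

Lemma slot_true_lt t : (slot (true, t) < K)%N.
Proof. by rewrite slot_trueE (leq_ltn_trans (geq_minl _ _))// prednK. Qed.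

Lemma slot_lt d : (slot d < K)%N = d.1.
Proof.
case: d => -[] t; first by rewrite slot_true_lt.
by rewrite /slot /= ltnn.
Qed.

Lemma slot_le t t' : t <= t' -> (slot (true, t) <= slot (true, t'))%N.
Proof.
move=> tt'; rewrite !slot_trueE leq_min geq_minl /=.
apply: leq_trans (geq_minr _ _) _; apply: le_truncn.
by rewrite ler_wpM2r.
Qed.

Lemma slot_lt_le t t' : (slot (true, t) < slot (true, t'))%N -> t <= t'.
Proof.
move=> h; rewrite leNgt; apply/negP => /ltW/slot_le; rewrite leqNgt.
by rewrite h.
Qed.

Lemma slot_trueP t (i : nat) : (i < K)%N -> ((slot (true, t) : nat) == i) =
  ((i == 0%N) || (i%:R / K%:R <= t)) && ((i.+1 == K) || (t < i.+1%:R / K%:R)).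
Proof.
move=> iK; have K0' : 0 < K%:R :> R by rewrite ltr0n.
have ge j : (j < K)%N -> (j <= slot (true, t))%N = (j == 0%N) || (j%:R / K%:R <= t).
  move=> jK; rewrite slot_trueE leq_min.
  have -> /= : (j <= K.-1)%N by rewrite -ltnS prednK.
  case: j jK => [|j] jK //=.
  by rewrite truncn_gt_nat ler_pdivrMr.
rewrite eqn_leq andbC ge//; congr (_ && _).
have [iK1|iK1] := eqVneq i.+1 K.
  by have := slot_true_lt t; rewrite -[X in (_ < X)%N]iK1 ltnS => ->.
have {iK1}iK1 : (i.+1 < K)%N by rewrite ltn_neqAle iK1.
by rewrite leqNgt ge//= -ltNge.
Qed.

Definition slot_itv (i : nat) : set R :=
  [set t | ((i == 0%N) || (i%:R / K%:R <= t)) && ((i.+1 == K) || (t < i.+1%:R / K%:R))].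

Lemma measurable_slot_itv i : measurable (slot_itv i : set (measurableTypeR R)).
Proof.
rewrite (_ : slot_itv i = [set t | (i == 0%N) || (i%:R / K%:R <= t)] `&`
    [set t | (i.+1 == K) || (t < i.+1%:R / K%:R)]); last first.
  by apply/seteqP; split=> t /andP.
apply: measurableI.
  case: (i == 0%N) => /=; first by rewrite [X in measurable X](_ : _ = setT)//; apply/seteqP.
  rewrite (_ : [set t | _] = `[i%:R / K%:R, +oo[%classic)//.
  by apply/seteqP; split=> t /=; rewrite in_itv/= andbT.
case: (i.+1 == K) => /=; first by rewrite [X in measurable X](_ : _ = setT)//; apply/seteqP.
by rewrite (_ : [set t | _] = `]-oo, i.+1%:R / K%:R[%classic)//; apply/seteqP; split.
Qed.

Lemma uniform_slot_itv i : (i < K)%N ->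
  uniform_prob (@ltr01 R) (slot_itv i) = (K%:R^-1)%:E.
Proof.
move=> iK; have K0' : 0 < K%:R :> R by rewrite ltr0n.
have i0 : 0 <= i%:R / K%:R :> R by rewrite divr_ge0.
have ii : i%:R / K%:R < i.+1%:R / K%:R :> R.
  by rewrite ltr_pM2r ?invr_gt0// ltr_nat.
have i1 : i.+1%:R / K%:R <= 1 :> R by rewrite ler_pdivrMr// mul1r ler_nat.
rewrite /uniform_prob integral_uniform_pdf.
rewrite (eq_integral (fun=> 1%:E)); last first.
  by move=> x; rewrite inE/= in_itv/= /uniform_pdf => -[_ ->]; rewrite subr0 invr1.
(* Inside [[0, 1]] only the last slot is not half-open: it also contains the point 1. *)
have [iK1|iK1] := eqVneq i.+1 K.
  have -> : slot_itv i `&` `[0, 1] = `[i%:R / K%:R, 1]%classic.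
    apply/seteqP; split=> t; rewrite /slot_itv /= !in_itv/= iK1 eqxx /= andbT.
      case=> + /andP[t0 ->]; rewrite andbT; case: eqP => [->|_]//=.
      by rewrite mul0r t0.
    by move=> /andP[it t1]; rewrite it orbT t1 (le_trans i0).
  rewrite integral_cst//= lebesgue_measure_itv/= lte_fin.
  rewrite (lt_le_trans ii)// mul1e -EFinD; congr (_%:E).
  rewrite -[X in X - _](@divff _ (K%:R : R)) ?lt0r_neq0// -{1}iK1 -natr1; field.
  exact: lt0r_neq0.
have -> : slot_itv i `&` `[0, 1] = `[i%:R / K%:R, i.+1%:R / K%:R[%classic.
  apply/seteqP; split=> t; rewrite /slot_itv /= !in_itv/= (negbTE iK1) /=.
    case=> /andP[+ ->] /andP[t0 _]; rewrite andbT; case: eqP => [->|_]//=.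
    by rewrite mul0r t0.
  move=> /andP[it ti]; rewrite it orbT ti (le_trans i0 it).
  by rewrite (le_trans (ltW ti)).
rewrite integral_cst//= lebesgue_measure_itv/= lte_fin ii mul1e -EFinD.
by congr (_%:E); rewrite -natr1; field; exact: lt0r_neq0.
Qed.

Variables (n : nat) (p : R).
Hypothesis p01 : 0 <= p <= 1.

Definition slots (w : sample R n) : {ffun vpair n -> 'I_K.+1} :=
  [ffun e => slot (pair_data w e)].

Lemma slot_preimage (i : 'I_K.+1) :
  slot @^-1` [set i] =
  if (i < K)%N then [set true] `*` slot_itv i else [set false] `*` setT.
Proof.
case: ifPn => iK; apply/seteqP; split=> -[b t] /=.
- move=> bi; have bT : b = true by have := slot_lt (b, t); rewrite bi iK.
  split=> //; move: bi; rewrite bT => /(congr1 val)/= /eqP.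
  by rewrite slot_trueP.
- case=> -> h; apply/val_inj/eqP => /=.
  by rewrite slot_trueP.
- move=> bi; split=> //; have := slot_lt (b, t); rewrite bi (negbTE iK).
  by case: b {bi}.
- case=> -> _; apply/val_inj => /=; apply/eqP.
  by rewrite eqn_leq leqNgt iK /= -ltnS ltn_ord.
Qed.

Lemma measurable_slot_preimage (i : 'I_K.+1) :
  measurable (slot @^-1` [set i] : set (bool * measurableTypeR R)).
Proof.
rewrite slot_preimage; case: ifP => _; apply: measurableX => //.
exact: measurable_slot_itv.
Qed.

Lemma slot_law (i : 'I_K.+1) (e : vpair n) :
  (bernoulli_prob p \x uniform_prob (@ltr01 R))%E (slot @^-1` [set i])
  = (slot_weight p e i)%:E.
Proof.
rewrite slot_preimage /slot_weight; case: ifP => iK.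
  rewrite product_measure1E//; last exact: measurable_slot_itv.
  rewrite [X in (_ * X)%E](_ : _ = (K%:R^-1)%:E); last exact: uniform_slot_itv.
  rewrite [X in (X * _)%E]bernoulli_probE// !diracE.
  by rewrite mem_set//= memNset//= mule0 adde0 mule1 -EFinM.
rewrite product_measure1E//.
rewrite [X in (_ * X)%E](_ : _ = 1%E); last exact: probability_setT.
rewrite [X in (X * _)%E]bernoulli_probE// !diracE.
by rewrite memNset//= mem_set//= mule0 add0e !mule1.
Qed.

Lemma Fnp_slots (x : {ffun vpair n -> 'I_K.+1}) :
  measurable [set w | slots w = x] /\
  Fnp n p [set w | slots w = x] = (wt (slot_weight p) x)%:E.
Proof.
pose B (i : 'I_#|{: vpair n}|) : set (bool * measurableTypeR R) :=
  slot @^-1` [set x (enum_val i)].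
have -> : [set w | slots w = x] = [set t : sample R n | forall i, B i (tnth t i)].
  apply/seteqP; split=> w /=.
    by move=> wx i; rewrite /B /= -wx ffunE /pair_data enum_valK.
  move=> h; apply/ffunP => e; rewrite ffunE; have := h (enum_rank e).
  by rewrite /B /= enum_rankK.
have mB i : measurable (B i) by exact: measurable_slot_preimage.
split.
  rewrite (_ : [set t | _] = \bigcap_(i in [set: 'I_#|{: vpair n}|])
      ((fun t : sample R n => tnth t i) @^-1` B i)); last first.
    by apply/seteqP; split => t /= h i; [move=> _|]; exact: h.
  apply: fin_bigcap_measurable => // i _.
  by rewrite -[X in measurable X]setTI; exact: measurable_tnth.
rewrite /Fnp iid_prod// /wt -prodEFin (reindex enum_rank) /=; last first.
  by exists enum_val => ? _; rewrite ?enum_valK ?enum_rankK.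
by apply: eq_bigr => e _; rewrite -slot_law /B enum_rankK.
Qed.

(** The bridge from measure theory to finite sums: an event decided by the slots is a finite
    disjoint union of rectangles. *)
Lemma Fnp_slots_pred (Q : pred {ffun vpair n -> 'I_K.+1}) :
  measurable [set w : sample R n | Q (slots w)] /\
  Fnp n p [set w | Q (slots w)] = (Ex (slot_weight p) (fun x => (Q x)%:R))%:E.
Proof.
pose F x := if Q x then [set w : sample R n | slots w = x] else set0.
have mF x : measurable (F x).
  by rewrite /F; case: ifP => // _; exact: (Fnp_slots x).1.
have -> : [set w : sample R n | Q (slots w)] = \bigcup_(x in setT) F x.
  apply/seteqP; split=> w /=; first by move=> Qw; exists (slots w); rewrite // /F Qw.
  by move=> [x _]; rewrite /F; case: ifP => // Qx /= ->.
split; first by apply: fin_bigcup_measurable => //; exact: finite_finset.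
have tF : trivIset setT F.
  apply/trivIsetP => x y _ _ xy; apply/seteqP; split=> // w [].
  rewrite /F; case: ifP => // _ /= wx; case: ifP => // _ /= wy.
  by rewrite -wx -wy eqxx in xy.
rewrite measure_fin_bigcup//; last exact: finite_finset.
transitivity (\sum_(x : {ffun vpair n -> 'I_K.+1}) Fnp n p (F x))%E.
  rewrite [RHS]fsbig_seq ?index_enum_uniq//; apply: eq_fsbigl.
  by apply/seteqP; split=> x //= _; rewrite mem_index_enum.
rewrite /Ex -sumEFin; apply: eq_bigr => x _.
rewrite /F; case: ifP => _; last by rewrite measure0 mulr0.
by rewrite (Fnp_slots x).2 mulr1.
Qed.

End Discretization.

(** * Temporal paths read off from slots *)

Section SlotPaths.
Context {R : realType} {n K : nat}.
Hypothesis K0 : (0 < K)%N.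
Implicit Types (w : sample R n) (u v a b : 'I_n) (s : seq 'I_n) (e : vpair n).

Lemma sample_label_val w e : sample_label w (val e) = (pair_data w e).2.
Proof. by rewrite /sample_label valK. Qed.

Lemma tadj_edge w e : (val e \in sample_edges w) = (pair_data w e).1.
Proof.
apply/imsetP/idP => [[e' + /val_inj ->]|we]; first by rewrite inE.
by exists e; rewrite ?inE.
Qed.

Lemma edge_times_path w u s : uniq (u :: s) ->
  edge_times (sample_tgraph w) u s = [seq (pair_data w e).2 | e <- path_edges u s].
Proof.
elim: s u => [|b s IH] u //.
rewrite cons_uniq in_cons negb_or -andbA => /and3P[ub _ us].
rewrite path_edges_cons /= -IH// -sample_label_val SubK.
by [].
Qed.

Lemma path_tadj w u s : uniq (u :: s) ->
  path (tadj (sample_tgraph w)) u s = all (fun e => (pair_data w e).1) (path_edges u s).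
Proof.
elim: s u => [|b s IH] u //.
rewrite cons_uniq in_cons negb_or -andbA => /and3P[ub _ us].
by rewrite path_edges_cons /= IH// -tadj_edge SubK.
Qed.

Lemma path_edges_rcons u s b (lb : last u s != b) :
  path_edges u (rcons s b) = rcons (path_edges u s) (Sub [set last u s; b]%SET (vpair2P lb)).
Proof.
elim: s u lb => [|a s IH] u /= lb; first by rewrite path_edges_cons.
rewrite /path_edges /=; case: insubP => [e _ _|_] /=; last exact: IH.
by congr (_ :: _); exact: IH.
Qed.

Lemma slots_lt w e : (slots K w e < K)%N = (pair_data w e).1.
Proof. by rewrite ffunE slot_lt. Qed.

Lemma slots_le w e e' : (pair_data w e).1 -> (pair_data w e').1 ->
  (pair_data w e).2 <= (pair_data w e').2 -> (slots K w e <= slots K w e')%N.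
Proof.
rewrite !ffunE; case: (pair_data w e) => -[] t //; case: (pair_data w e') => -[] t' // _ _.
exact: slot_le.
Qed.

Lemma slots_lt_le w e e' : (pair_data w e).1 -> (pair_data w e').1 ->
  (slots K w e < slots K w e')%N -> (pair_data w e).2 <= (pair_data w e').2.
Proof.
rewrite !ffunE; case: (pair_data w e) => -[] t //; case: (pair_data w e') => -[] t' // _ _.
exact: slot_lt_le.
Qed.

(* Strictly increasing slots certify nondecreasing labels, so the vertices
   collected by [run] are all reached by temporal paths. *)
Definition reached w v (j : nat) (A : {set 'I_n}) := forall a, a \in A -> exists s,
  [/\ temporal_path (sample_tgraph w) v a s, {subset v :: s <= A} &
      all (fun e => slots K w e < j)%N (path_edges v s)].

Lemma reached_grow w v j A : (j < K)%N -> reached w v j A ->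
  reached w v j.+1 (grow A (hit A j (slots K w))).
Proof.
move=> jK hA b; rewrite inE.
have sG := sub_grow A (hit A j (slots K w)).
have [bA _|bA /=] := boolP (b \in A).
  have [s [ts sA sj]] := hA b bA; exists s; split => //.
    by move=> a /sA; exact/fintype.subsetP.
  by apply: sub_all sj => e /= /ltnW.
move=> /bigcupP[e eh be]; have := eh; rewrite !inE => /andP[/andP[/set0Pn[a]]].
rewrite inE => /andP[ae aA] _ /eqP ej.
have ab : a != b by apply: contraNneq bA => <-.
have eE : e = Sub [set a; b]%SET (vpair2P ab).
  apply/val_inj/esym/eqP; rewrite SubK eqEcard (eqP (valP e)) cards2 ab andbT.
  by apply/fintype.subsetP => c; rewrite !inE => /orP[] /eqP->.
have [s [[ps us ls ss] sA sj]] := hA a aA.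
(* The path to [a] stays inside [A], so appending [b] keeps it simple; this is why [reached] records
   the inclusion. *)
have us' : uniq (v :: rcons s b).
  by rewrite -rcons_cons rcons_uniq us andbT; apply: contra bA; exact: sA.
have e1 : (pair_data w e).1 by rewrite -slots_lt ej.
have lb : last v s != b by rewrite ls.
have pe : path_edges v (rcons s b) = rcons (path_edges v s) e.
  by rewrite (path_edges_rcons lb) eE; congr rcons; apply/val_inj; rewrite /= ls.
move: ps ss; rewrite path_tadj// edge_times_path// => ps ss.
exists (rcons s b); split; first split=> //.
- by rewrite path_tadj// pe all_rcons e1.
- by rewrite last_rcons.
- rewrite edge_times_path// pe map_rcons.
  (* In pairwise form, the new label only has to be compared with the earlier ones, whose slots are
     all below [j]. *)
  move: ss; rewrite !(sorted_pairwise (@le_trans _ R)) pairwise_rcons => ->.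
  rewrite andbT all_map; apply/allP => e' e's /=.
  apply: slots_lt_le => //; first exact: (allP ps).
  by rewrite ej; exact: (allP sj).
- move=> c; rewrite -rcons_cons mem_rcons in_cons => /orP[/eqP->|/sA cA].
    by apply: (fintype.subsetP (edge_sub_grow A eh)).
  exact: (fintype.subsetP sG).
- rewrite pe all_rcons ej ltnSn /=.
  by apply: sub_all sj => e' /= /ltnW.
Qed.

Lemma run_reached w v d j A : (j + d <= K)%N -> reached w v j A ->
  reached w v (j + d) (run (slots K w) d j A).
Proof.
elim: d j A => [|d IH] j A jd hA /=; first by rewrite addn0.
rewrite -addSnnS; apply: IH; first by rewrite addSnnS.
by apply: reached_grow => //; apply: leq_trans jd; rewrite addnS ltnS leq_addr.
Qed.

Lemma run_temporal_source w v :
  run (slots K w) K 0 [set v]%SET = finset.setT ->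
  temporal_source (sample_tgraph w) v.
Proof.
move=> rT a _.
have := @run_reached w v K 0 [set v]%SET (leqnn K).
rewrite rT => h.
have hv : reached w v 0 [set v]%SET.
  move=> b; rewrite inE => /eqP->; exists [::]; split=> //.
  by move=> c; rewrite !inE.
by have [|s [ts _ _]] := h hv a; [rewrite inE|exists s].
Qed.

End SlotPaths.

(** The last edge of a path to [b] is present and not late, hence early; since labels do not
    decrease along the path, all the earlier edges are early too. *)
Lemma source_early_path (R : realType) (n h : nat) (w : sample R n) (v b : 'I_n) :
  (0 < h)%N -> temporal_source (sample_tgraph w) v -> b != v ->
  late_isolated b (slots h.*2 w) -> exists s,
    uniq (v :: rcons s b) /\
    sorted_below h (path_edges v (rcons s b)) 0 (slots h.*2 w).
Proof.
move=> h0 sv bv /forallP iso; have K0 : (0 < h.*2)%N by rewrite double_gt0.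
have [s [ps us ls ss]] := sv b bv.
case/lastP: s ps us ls ss => [_ _ /= vb|s a]; first by rewrite vb eqxx in bv.
rewrite last_rcons => ps us ab; rewrite {a}ab in ps us * => ss.
exists s; split=> //.
have lb : last v s != b.
  move: us; rewrite -rcons_cons rcons_uniq => /andP[+ _].
  by apply: contra => /eqP <-; exact: mem_last.
move: ps ss; rewrite path_tadj// edge_times_path// (path_edges_rcons lb).
set e := Sub _ _ => ps ss.
have eh : (slots h.*2 w e < h)%N.
  have := iso e; rewrite /late_free /late SubK !inE eqxx orbT /= negb_and -leqNgt -ltnNge.
  case/orP => //; rewrite leqNgt slots_lt//.
  by move: ps; rewrite all_rcons => /andP[->].
have sl : sorted leq [seq (slots h.*2 w e : nat) | e <- rcons (path_edges v s) e].
  move: ss; rewrite !sorted_map; apply: sub_in_sorted ps.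
  by move=> e1 e2 p1 p2 /=; exact: slots_le.
rewrite /sorted_below path_min_sorted ?sl; last exact/allP.
move: sl; rewrite map_rcons (sorted_pairwise leq_trans) pairwise_rcons => /andP[al _].
rewrite all_rcons eh /=; apply/allP => e' e's.
by apply: leq_ltn_trans eh; move: al; rewrite all_map => /allP/(_ e' e's).
Qed.

(** * Elementary inequalities for powers, exponentials and harmonic sums *)

Section RealBounds.
Context {R : realType}.
Implicit Types (x q : R).

Lemma expn_1sub_le q c : 0 <= q <= 1 ->
  (1 - q) ^+ c <= 1 - c%:R * q + (c%:R * q) ^+ 2.
Proof.
move=> /andP[q0 q1]; elim: c => [|c IH]; first by rewrite expr0 mul0r expr0n /= subr0 addr0.
rewrite exprSr; have q1' : 0 <= 1 - q by lra.
apply: (le_trans (ler_wpM2r q1' IH)).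
rewrite -natr1; have : 0 <= c%:R :> R by [].
move: (c%:R : R) => d d0; rewrite -subr_ge0.
have -> : 1 - (d + 1) * q + ((d + 1) * q) ^+ 2 -
  (1 - d * q + (d * q) ^+ 2) * (1 - q) = q ^+ 2 * (d + 1 + d ^+ 2 * q) by ring.
by rewrite mulr_ge0 ?sqr_ge0// !addr_ge0// mulr_ge0// sqr_ge0.
Qed.

Lemma invr_1sub_le_expR x : x < 1 -> (1 - x)^-1 <= expR (x / (1 - x)).
Proof.
move=> x1; have e : (1 - x)^-1 = 1 + x / (1 - x) by field; lra.
by rewrite {1}e; exact: expR_ge1Dx.
Qed.

Lemma expR_ge_sqr x : 0 <= x -> x ^+ 2 / 4 <= expR x.
Proof.
move=> x0; have -> : expR x = expR (x / 2) ^+ 2.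
  by rewrite -expRM_natl; congr expR; field.
 have := expR_ge1Dx (x / 2); set e := expR _ => xe; nra.
Qed.

Lemma expR_ge_cube x : 0 <= x -> x ^+ 3 / 27 <= expR x.
Proof.
move=> x0; have -> : expR x = expR (x / 3) ^+ 3.
  by rewrite -expRM_natl; congr expR; field.
have -> : x ^+ 3 / 27 = (x / 3) ^+ 3 by field.
apply: lerXn2r; rewrite ?nnegrE ?expR_ge0 ?divr_ge0//.
by apply: le_trans (expR_ge1Dx (x / 3)); lra.
Qed.

Lemma harmonic_le (m : nat) : (0 < m)%N ->
  \sum_(1 <= i < m.+1) i%:R^-1 <= 1 + ln m%:R :> R.
Proof.
case: m => // m _; elim: m => [|m IH]; first by rewrite big_nat1 invr1 ln1 addr0.
rewrite big_nat_recr //=; apply: (le_trans (lerD IH (lexx _))).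
rewrite -addrA lerD2l -lerBrDl -ln_div ?posrE ?ltr0n//.
(* With [x = 1 / (m + 2)], the bound [x <= ln ((m + 2) / (m + 1))] amounts to
   [1 - x <= expR (- x)]. *)
rewrite -[leLHS]opprK lerNl -lnV ?posrE ?divr_gt0 ?ltr0n// invf_div.
apply: (@le_trans _ _ (ln (expR (- m.+2%:R^-1)))); last by rewrite expRK.
rewrite ler_ln ?posrE ?expR_gt0 ?divr_gt0 ?ltr0n//.
apply: le_trans (expR_ge1Dx _).
rewrite -(@natr1 R m.+1) le_eqVlt; apply/orP; left; apply/eqP; field.
by rewrite nat1r natr1 pnatr_eq0.
Qed.

End RealBounds.

(** * Transfer of the slot bounds to the random temporal graph *)

Section FixedSize.
Context {R : realType} {n : nat}.
Variables (p : R) (v : 'I_n).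
Hypothesis p01 : 0 <= p <= 1.

Lemma source_prob_lb (K : nat) : (0 < K)%N ->
  ((1 - Ex (@slot_weight R n K p) (fun x =>
     (run x K 0 [set v]%SET != finset.setT)%:R))%:E
  <= Fnp_prob p (fun g => temporal_source g v))%E.
Proof.
move=> K0; rewrite /Fnp_prob.
have [mQ PQ] := Fnp_slots_pred K0 p01 (fun x => run x K 0 [set v]%SET == finset.setT).
apply: (@le_trans _ _ (Fnp n p [set w |
    run (slots K w) K 0 [set v]%SET == finset.setT])).
  rewrite PQ lee_fin lerBlDr -ExD -[leLHS](@mass_slot_weight R n K p K0) -Ex1.
  apply: le_Ex => [e i|x]; first exact: slot_weight_ge0.
  by case: eqP => _; rewrite /= ?addr0 ?add0r.
apply: le_measure; rewrite ?inE//; first exact: temporal_source_measurable.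
by move=> w /= /eqP; exact: run_temporal_source.
Qed.

Lemma not_source_prob_lb (h : nat) (bd : R) : (0 < h)%N ->
  (forall Q : pred {ffun vpair n -> 'I_(h.*2).+1},
    (forall x w, Q x -> w != v -> late_isolated w x -> exists s,
      uniq (v :: rcons s w) /\ sorted_below h (path_edges v (rcons s w)) 0 x) ->
    Ex (slot_weight p) (fun x => (Q x)%:R) <= bd) ->
  ((1 - bd)%:E <= Fnp_prob p (fun g => ~ temporal_source g v))%E.
Proof.
move=> h0 HQ; rewrite /Fnp_prob.
have mS := @temporal_source_measurable R n v.
rewrite (_ : [set w | _] = ~` [set w | temporal_source (sample_tgraph w) v])//.
rewrite probability_setC// EFinB leeB//.
(* Being a source is enlarged to an event decided by the slots alone: every late-isolated vertex is
   reached early. *)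
pose Q (x : {ffun vpair n -> 'I_(h.*2).+1}) := `[< forall w,
  w != v -> late_isolated w x -> exists s,
      uniq (v :: rcons s w) /\ sorted_below h (path_edges v (rcons s w)) 0 x >].
have K0 : (0 < h.*2)%N by rewrite double_gt0.
have [mQ PQ] := Fnp_slots_pred K0 p01 Q.
apply: (@le_trans _ _ (Fnp n p [set w | Q (slots h.*2 w)])).
  apply: le_measure; rewrite ?inE//.
  move=> w /= sw; apply/asboolP => b bv ib.
  exact: source_early_path ib.
rewrite PQ lee_fin; apply: HQ => x w /asboolP; exact.
Qed.

(** Serves the sharp threshold with [eps > 1], where [(1 - eps) * p] can be negative:
    [bernoulli_prob] is then the mass at [false] and the graph is almost surely empty. *)
Lemma not_source_negative : (1 < n)%N -> forall p' : R, p' < 0 ->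
  Fnp_prob p' (fun g => ~ temporal_source g v) = 1%E.
Proof.
move=> n1 p' p'0; apply/eqP; rewrite eq_le; apply/andP; split.
  apply: probability_le1.
  rewrite (_ : [set w | _] = ~` [set w | temporal_source (sample_tgraph w) v])//.
  by apply: measurableC; exact: temporal_source_measurable.
pose B (_ : 'I_#|{: vpair n}|) : set (bool * measurableTypeR R) := [set false] `*` setT.
have mB i : measurable (B i) by exact: measurableX.
have : Fnp n p' [set t | forall i, B i (tnth t i)] = 1%E.
  rewrite /Fnp iid_prod// big1// => i _.
  transitivity ((bernoulli_prob p' \x uniform_prob (@ltr01 R))%E
    ([set false] `*` setT)); first by [].
  rewrite product_measure1E//.
  rewrite [X in (_ * X)%E](_ : _ = 1%E); last exact: probability_setT.
  rewrite mule1 /= /bernoulli_prob leNgt p'0 /= diracE mem_set//.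
move=> <-; apply: le_measure; rewrite ?inE.
- rewrite (_ : [set t | _] = \bigcap_(i in [set: 'I_#|{: vpair n}|])
      ((fun t : sample R n => tnth t i) @^-1` B i)); last first.
    by apply/seteqP; split => t /= h i; [move=> _|]; exact: h.
  apply: fin_bigcap_measurable => // i _.
  by rewrite -[X in measurable X]setTI; exact: measurable_tnth.
- rewrite (_ : [set w | _] = ~` [set w | temporal_source (sample_tgraph w) v])//.
  by apply: measurableC; exact: temporal_source_measurable.
move=> w /= hw sv.
have [b bv] : exists b : 'I_n, b != v.
  have : (0 < #|predC1 v|)%N by rewrite cardC1 card_ord -subn1 subn_gt0.
  by case/card_gt0P => b; rewrite inE => bv; exists b.
have [[|a s] [/= ps _ ls _]] := sv b bv; first by rewrite ls eqxx in bv.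
move: ps => /andP[+ _]; rewrite /tadj => /imsetP[e + _].
by rewrite inE; have := hw (enum_rank e); rewrite /B /pair_data /= => -[-> _].
Qed.

End FixedSize.

(** * Exponential moment bound for the spreading time *)

Section SpreadBound.
Context {R : realType} {n : nat}.
Variables (p s : R) (v : 'I_n).
Hypotheses (p01 : 0 <= p <= 1) (n1 : (1 < n)%N) (s0 : 0 <= s <= 1 / 4).
(** With [n ^ 3] slots the second-order error [n ^ 2 * q] is at most [1 / n]; over all slots it
    costs only the summand [s] in [rho_expn_le]. *)
Let K := (n ^ 3)%N.
Let q : R := p / K%:R.
Let ratio (i : nat) : R := s * n%:R / (i * (n - i))%:R.
(* The Laplace transform, at [s * n * p], of a sum of independent exponential
   waiting times of rates [i * (n - i) * p]. *)
Let f (k : nat) : R := \prod_(k <= i < n) (1 - ratio i)^-1.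
Let rho : R := 1 - s * n%:R * q * (1 - n%:R ^+ 2 * q).

Let n0 : 0 < n%:R :> R. Proof. by rewrite ltr0n (ltnW n1). Qed.

Lemma card_pair_ge i : (0 < i < n)%N -> (n - 1 <= i * (n - i))%N.
Proof.
move=> /andP[i0 i_n]; rewrite -{1}(subnKC (ltnW i_n)).
have : (0 < n - i)%N by rewrite subn_gt0.
by move: (n - i)%N => j j0; nia.
Qed.

(** Rests on [i * (n - i) >= n - 1 >= n / 2]. As [s <= 1 / 4], the factors [1 - ratio i] of the
    potential stay at least 1/2. *)
Lemma ratio_bound i : (0 < i < n)%N -> 0 <= ratio i <= 2 * s.
Proof.
move=> iin; have /andP[s_ge0 _] := s0.
have c0 : 0 < (i * (n - i))%:R :> R.
  by rewrite ltr0n muln_gt0 subn_gt0 andbC; case/andP: iin => -> ->.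
apply/andP; split; first by rewrite /ratio divr_ge0 ?mulr_ge0.
rewrite /ratio ler_pdivrMr// -mulrA mulrCA ler_wpM2l//.
rewrite -natrM ler_nat; have := card_pair_ge iin.
by move: (i * (n - i))%N => j; lia.
Qed.

Lemma potential_ge1 i : (0 < i)%N -> 1 <= f i.
Proof.
move=> i0; rewrite /f big_nat.
apply: (big_ind (fun x => 1 <= x)) => // [x y x1 y1|j /andP[ij jn]].
  by rewrite -[leLHS]mulr1 ler_pM.
have /andP[r0 r1] : 0 <= ratio j <= 2 * s.
  by apply: ratio_bound; rewrite (leq_trans i0).
by have /andP[_ s1] := s0; rewrite invf_ge1; lra.
Qed.

Lemma potential_rec k : (k < n)%N -> f k = (1 - ratio k)^-1 * f k.+1.
Proof. by move=> kn; rewrite /f big_ltn. Qed.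

Lemma potential_mono i j : (0 < i <= j)%N -> (j <= n)%N -> f j <= f i.
Proof.
move=> /andP[i0 ij] jn; rewrite /f (big_cat_nat ij jn)//= ler_peMl//.
  by apply: le_trans (potential_ge1 (leq_trans i0 ij)).
rewrite big_nat.
apply: (big_ind (fun x => 1 <= x)) => // [x y x1 y1|k /andP[ik kj]].
  by rewrite -[leLHS]mulr1 ler_pM.
have /andP[r0 r1] : 0 <= ratio k <= 2 * s.
  by apply: ratio_bound; rewrite (leq_trans i0)//= (leq_trans kj).
by have /andP[_ s1] := s0; rewrite invf_ge1; lra.
Qed.

Let K0 : 0 < K%:R :> R. Proof. by rewrite ltr0n expn_gt0 ltnW. Qed.

Let q0 : 0 <= q. Proof. by have /andP[p0 _] := p01; rewrite divr_ge0// ltW. Qed.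

Let nq : n%:R ^+ 3 * q <= 1.
Proof.
have /andP[_ p1] := p01.
by rewrite /q /K natrX mulrCA mulfV ?mulr1// expf_neq0 ?lt0r_neq0.
Qed.

Let nge1 : 1 <= n%:R :> R. Proof. by rewrite ler1n ltnW. Qed.

Let n2q : n%:R ^+ 2 * q <= 1.
Proof.
by apply: le_trans nq; rewrite ler_wpM2r// ler_weXn2l.
Qed.

Let n1q : n%:R * q <= 1.
Proof.
by apply: le_trans n2q; rewrite ler_wpM2r// expr2 ler_peMr// ltW.
Qed.

Let q1 : q <= 1.
Proof. by apply: le_trans n1q; rewrite ler_peMl//. Qed.

Lemma rho_ge0 : 0 <= rho.
Proof.
have /andP[s_ge0 s1] := s0.
have a0 : 0 <= s * n%:R * q by apply: mulr_ge0 => //; apply: mulr_ge0.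
have a1 : s * n%:R * q <= 1.
  rewrite -mulrA -[leRHS]mul1r; apply: ler_pM => //; last lra.
  exact: mulr_ge0.
have b0 : 0 <= n%:R ^+ 2 * q by apply: mulr_ge0 => //; exact: exprn_ge0.
rewrite /rho; move: n2q; move: (s * n%:R * q) (n%:R ^+ 2 * q) a0 a1 b0 => a b *; nra.
Qed.

(** A hit occurs with probability at least about [k * (n - k) * q] and multiplies the potential by
    [1 - ratio k]. The factor [k * (n - k)] cancels against the denominator of [ratio k], so the
    decay [rho] does not depend on [k]. *)
Lemma potential_step k : (0 < k < n)%N ->
  let z := (1 - q) ^+ (k * (n - k)) in f k * z + f k.+1 * (1 - z) <= rho * f k.
Proof.
move=> kn /=; set z := (1 - q) ^+ _; have /andP[k0 k_n] := kn.
have /andP[s_ge0 s1] := s0.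
have /andP[r0 r1] := ratio_bound kn.
have fk : f k.+1 = f k * (1 - ratio k).
  by rewrite (potential_rec k_n) mulrAC mulVf ?mul1r//; lra.
have fk0 : 0 <= f k by apply: le_trans (potential_ge1 k0).
suff h : s * n%:R * q * (1 - n%:R ^+ 2 * q) <= ratio k * (1 - z).
  rewrite fk /rho.
  have := ler_wpM2l fk0 h.
  by move: (s * n%:R * q * _) (f k) (ratio k) => a F r; lra.
have := @expn_1sub_le R q (k * (n - k)) (introT andP (conj q0 q1)).
rewrite -/z; set c := (k * (n - k))%:R => hz.
have c0 : 0 < c by rewrite ltr0n muln_gt0 k0 subn_gt0.
have cn : c <= n%:R ^+ 2.
  by rewrite -natrX ler_nat -mulnn leq_mul ?leq_subr// ltnW.
have h1 : c * q * (1 - n%:R ^+ 2 * q) <= 1 - z.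
  apply: (@le_trans _ _ (c * q * (1 - c * q))); last by move: hz; lra.
  apply: ler_wpM2l; first by apply: mulr_ge0; rewrite // ltW.
  by rewrite lerD2l lerN2 ler_wpM2r.
apply: le_trans (ler_wpM2l r0 h1).
by rewrite /ratio -/c !(mulrA (_ / c)) divfK ?lt0r_neq0.
Qed.

Lemma ratioE i : (0 < i < n)%N -> ratio i = s * (i%:R^-1 + (n - i)%:R^-1).
Proof.
move=> /andP[i0 i_n]; rewrite /ratio natrM.
have -> : n%:R = i%:R + (n - i)%:R :> R by rewrite -natrD subnKC// ltnW.
by field; rewrite !pnatr_eq0 -!lt0n i0 subn_gt0 i_n.
Qed.

(** Partial fractions give two harmonic sums, one for the start and one for the end of the spread;
    hence the 2 in the threshold. *)
Lemma sum_ratio : \sum_(1 <= i < n) ratio i <= 2 * s * (1 + ln n%:R).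
Proof.
have /andP[s_ge0 _] := s0.
rewrite (eq_big_nat _ _ ratioE) -big_distrr /= (mulrC 2) -mulrA ler_wpM2l//.
rewrite big_split /=.
have -> : \sum_(1 <= i < n) (n - i)%:R^-1 = \sum_(1 <= i < n) i%:R^-1 :> R.
  rewrite big_nat_rev /= !big_nat; apply: eq_bigr => i /andP[i1 i_n].
  by rewrite add1n subSS subKn// ltnW.
have : \sum_(1 <= i < n) i%:R^-1 <= 1 + ln n%:R :> R; last by lra.
case: n n1 => // m m1; apply: (le_trans (harmonic_le m1)).
by rewrite lerD2l ler_ln ?posrE ?ltr0n// ler_nat.
Qed.

Lemma potential1_le : f 1 <= expR (2 * s * (1 + ln n%:R) / (1 - 2 * s)).
Proof.
have /andP[s_ge0 s1] := s0.
apply: (@le_trans _ _ (expR (\sum_(1 <= i < n) ratio i / (1 - 2 * s)))); last first.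
  by rewrite ler_expR -big_distrl /= ler_pM2r ?sum_ratio// invr_gt0; lra.
rewrite expR_sum /f !big_nat; apply: ler_prod => i iin.
have /andP[r0 r1] := ratio_bound iin.
apply/andP; split; first by rewrite invr_ge0; lra.
apply: le_trans (invr_1sub_le_expR _) _; first lra.
by rewrite ler_expR ler_wpM2l// lef_pV2 ?posrE; lra.
Qed.

Lemma rho_expn_le : rho ^+ K <= expR (- (s * n%:R * p) + s).
Proof.
have /andP[s_ge0 s1] := s0; have /andP[p0 p1] := p01.
apply: (@le_trans _ _ (expR (- (s * n%:R * q * (1 - n%:R ^+ 2 * q))) ^+ K)).
  apply: lerXn2r; rewrite ?nnegrE ?expR_ge0 ?rho_ge0//.
  exact: expR_ge1Dx.
rewrite -expRM_natl ler_expR.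
have Kq : K%:R * q = p by rewrite mulrC divfK ?lt0r_neq0.
have -> : K%:R * - (s * n%:R * q * (1 - n%:R ^+ 2 * q))
    = - (s * n%:R * p) + s * (n%:R ^+ 3 * q) * p.
  by rewrite -Kq; move: (K%:R : R) (q : R) => k q'; ring.
rewrite lerD2l -mulrA -[leRHS]mulr1 ler_wpM2l//.
by rewrite -[leRHS]mulr1 ler_pM// mulr_ge0// exprn_ge0// ltW.
Qed.

Lemma spread_fail_le :
  Ex (@slot_weight R n K p) (fun x => (run x K 0 [set v]%SET != finset.setT)%:R)
  <= expR (2 * s * (1 + ln n%:R) / (1 - 2 * s) - s * n%:R * p + s).
Proof.
have KN : (0 < K)%N by rewrite expn_gt0 (ltnW n1).
have qq : 0 <= q <= 1 by rewrite q0 q1.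
apply: le_trans (@run_fail n K R f q rho qq rho_ge0 potential_mono _
  potential_step K _ 0 _ _ _ _ _) _.
- by move=> i /andP[i0 _]; exact: potential_ge1.
- by move=> e i; exact: slot_weight_ge0.
- move=> e i _ /= iK; by rewrite slot_weight_sum1// mulr1 /slot_weight iK.
- by [].
- by rewrite cards1.
rewrite mass_slot_weight// mul1r cards1 -addrA expRD.
rewrite ler_pM ?potential1_le ?rho_expn_le ?exprn_ge0 ?rho_ge0//.
by rewrite (le_trans ler01)// potential_ge1.
Qed.

End SpreadBound.

Lemma leq_double_pred m : (1 < m)%N -> (m <= 2 * (m - 1))%N.
Proof. lia. Qed.

(** * Explicit subcritical error bound *)

Section NotSourceBound.
Context {R : realType} {n : nat}.
Variables (p : R) (v : 'I_n).
Let L : R := ln n%:R.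
Hypotheses (p01 : 0 <= p <= 1) (n1 : (1 < n)%N) (L1 : 1 <= L).
Hypotheses (nL : 4 * L ^+ 2 <= n%:R) (pL : n%:R * p <= 2 * L).
Let h := (n ^ 3)%N.
Let a : R := n%:R * p / 2.
Let c : R := 1 - p / 2.

Let n0 : 0 < n%:R :> R. Proof. by rewrite ltr0n (ltnW n1). Qed.
Let h0 : (0 < h)%N. Proof. by rewrite expn_gt0 (ltnW n1). Qed.
Let hR0 : 0 < h%:R :> R. Proof. by rewrite ltr0n. Qed.
Let nh : n%:R <= h%:R :> R.
Proof. by rewrite ler_nat /h; have := n1; nia. Qed.

Let L0 : 0 <= L. Proof. exact: le_trans ler01 L1. Qed.

Let a0 : 0 <= a.
Proof. by have /andP[? _] := p01; rewrite divr_ge0// mulr_ge0// ltW. Qed.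

Let c_lb : (1 - L / n%:R) <= c.
Proof.
by rewrite /c lerD2l lerN2 ler_pdivlMr//; move: pL; lra.
Qed.

Let c0 : 0 < c. Proof. by have /andP[? ?] := p01; rewrite /c; lra. Qed.

(** Since [a <= L] and the relative error [2 * L / n] is at most [1 / (2 * L)], such a division
    costs at most 1 in the exponent. *)
Let div_le (x : R) : 1 - 2 * (L / n%:R) <= x -> a / x <= a + 1.
Proof.
have d0 : 0 <= L / n%:R by exact: divr_ge0.
have Ld : 4 * (L * (L / n%:R)) <= 1.
  by rewrite !mulrA ler_pdivrMr// mul1r -mulrA -expr2.
have aL : a <= L by rewrite /a; move: pL; lra.
move: (L : R) (L / n%:R) (a : R) a0 L1 d0 Ld aL => l d b b0 l1 d0 ld bl dx.
have ad : b * d <= l * d by rewrite ler_wpM2r.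
have dL : d <= l * d by rewrite ler_peMl.
have x0 : 0 < x by lra.
rewrite ler_pdivrMr//; apply: (@le_trans _ _ ((b + 1) * (1 - 2 * d))).
  lra.
by apply: ler_wpM2l => //; lra.
Qed.

Let ac : a / c <= a + 1.
Proof.
apply: div_le; apply: le_trans c_lb; rewrite lerD2l lerN2 ler_peMl ?ler1n//.
exact: divr_ge0.
Qed.

Let q : R := p / (h.*2)%:R / c.

Let nqE : n%:R * q = a / c / h%:R.
Proof.
rewrite /q /a -mul2n natrM.
move: (h%:R : R) hR0 (c : R) c0 (n%:R : R) => k k0 c' c'0 m.
by field; rewrite !lt0r_neq0.
Qed.

Let nq1 : n%:R * q < 1.
Proof.
rewrite nqE ltr_pdivrMr// mul1r (le_lt_trans ac)//.
have aL : a <= L by rewrite /a; move: pL; lra.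
apply: lt_le_trans nh; apply: lt_le_trans nL.
by move: (L : R) (a : R) L1 aL => l b l1 bl; nra.
Qed.

Let early_le : (1 - n%:R * q)^-1 ^+ h <= expR (a + 1).
Proof.
have nq0 : 0 <= n%:R * q.
  by rewrite nqE; apply: divr_ge0 => //; apply: divr_ge0 => //; exact: ltW.
apply: (@le_trans _ _ (expR (n%:R * q / (1 - n%:R * q)) ^+ h)).
  apply: lerXn2r; rewrite ?nnegrE ?expR_ge0 ?invr_ge0 ?subr_ge0 ?(ltW nq1)//.
  exact: invr_1sub_le_expR.
rewrite -expRM_natl ler_expR.
have -> : h%:R * (n%:R * q / (1 - n%:R * q)) = a / (c * (1 - n%:R * q)).
  have d0 : 1 - n%:R * q != 0 by rewrite gt_eqF// subr_gt0.
  move: (1 - n%:R * q) d0 => d d0; rewrite nqE.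
  move: (h%:R : R) hR0 (c : R) c0 => k k0 c' c'0.
  by field; rewrite d0 (lt0r_neq0 k0) (lt0r_neq0 c'0).
(* Both corrections are merged into one denominator, [c - a / h], and each of them is at most
   [L / n]. *)
apply: div_le; rewrite mulrBr mulr1 nqE.
have -> : c * (a / c / h%:R) = a / h%:R.
  by rewrite mulrA mulrCA mulfV ?mulr1 ?lt0r_neq0.
have : a / h%:R <= L / n%:R.
  apply: ler_pM => //; rewrite ?lef_pV2 ?posrE//.
  by rewrite /a; move: pL; lra.
move: c_lb; lra.
Qed.

Let isolated_le : ((n - 1)%:R * c ^+ n)^-1 <= 2 * (expR (a + 1) / n%:R).
Proof.
have n10 : 0 < (n - 1)%:R :> R by rewrite ltr0n subn_gt0.
have -> : 2 * (expR (a + 1) / n%:R) = 2 / n%:R * expR (a + 1).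
  by rewrite mulrCA mulrC.
rewrite invfM; apply: ler_pM.
- by rewrite invr_ge0.
- by rewrite invr_ge0 exprn_ge0// ltW.
- rewrite -[leLHS]mul1r ler_pdivrMr// mulrAC ler_pdivlMr// mul1r.
  by rewrite -natrM ler_nat leq_double_pred.
rewrite -exprVn; apply: (@le_trans _ _ (expR (p / 2 / c) ^+ n)).
  apply: lerXn2r; rewrite ?nnegrE ?expR_ge0 ?invr_ge0 ?(ltW c0)//.
  by rewrite /c; apply: invr_1sub_le_expR; rewrite -subr_gt0.
by rewrite -expRM_natl ler_expR !mulrA.
Qed.

(** The inverse mean contributes [4 * 2] and the early paths 2 to the coefficient 10;
    [c^-1 - 1 <= p <= 2 * L / n] accounts for the 8. *)
Lemma not_source_bound :
  4 * (((n - 1)%:R * c ^+ n)^-1 + c^-1 - 1) + 2 * ((1 - n%:R * q)^-1 ^+ h / n%:R)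
  <= 10 * expR (a + 1 - L) + 8 * (L / n%:R).
Proof.
have /andP[p0 p1] := p01.
have nE : n%:R^-1 = expR (- L) by rewrite expRN lnK.
have e1 : expR (a + 1 - L) = expR (a + 1) / n%:R by rewrite expRD nE.
have e2 : (1 - n%:R * q)^-1 ^+ h / n%:R <= expR (a + 1) / n%:R.
  by rewrite ler_pM2r ?invr_gt0.
have e3 : c^-1 - 1 <= 2 * (L / n%:R).
  have -> : c^-1 - 1 = p / 2 / c by rewrite /c; field; lra.
  apply: (@le_trans _ _ p).
    by rewrite ler_pdivrMr// /c; nra.
  by rewrite mulrA ler_pdivlMr// mulrC.
have := isolated_le; rewrite e1; lra.
Qed.

Lemma not_source_prob_explicit :
  ((1 - (10 * expR (a + 1 - L) + 8 * (L / n%:R)))%:E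
   <= Fnp_prob p (fun g => ~ temporal_source g v))%E.
Proof.
apply: (not_source_prob_lb p01 h0) => Q HQ.
apply: le_trans not_source_bound.
exact: (source_late_bound p01 h0 n1 nq1 HQ).
Qed.

End NotSourceBound.

(** * Estimates in terms of the fifth root of [ln n] *)

Section Asymptotics.
Context {R : realType}.

Lemma ln_natr_ge (Y : R) : exists N, forall n, (N <= n)%N -> Y <= ln n%:R :> R.
Proof.
exists (Num.truncn (expR Y)).+1 => n Nn.
have Yn : expR Y < n%:R by rewrite (lt_le_trans (truncnS_gt _))// ler_nat.
have n0 : 0 < n%:R :> R by exact: lt_trans (expR_gt0 _) Yn.
by rewrite -[leLHS]expRK ler_ln ?posrE ?expR_gt0// ltW.
Qed.

(** Working with the fifth root [y] turns the powers 1 and 0.8 of [L] into [y ^+ 5] and [y ^+ 4], so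
    the later estimates become polynomial. *)
Lemma fifth_root (L : R) : 0 <= L ->
  exists y, [/\ 0 <= y, L = y ^+ 5 & L `^ (8 / 10) = y ^+ 4].
Proof.
move=> L0; exists (L `^ (1 / 5)); split; first exact: powR_ge0.
- rewrite -powR_mulrn ?powR_ge0// -powRrM.
  by rewrite (_ : 1 / 5 * 5 = 1) ?powRr1//; field.
- rewrite -powR_mulrn ?powR_ge0// -powRrM.
  by congr (_ `^ _); field.
Qed.

Variables (n : nat) (p y : R) (v : 'I_n).
Let L : R := ln n%:R.
Hypotheses (p01 : 0 <= p <= 1) (y60 : 60 <= y) (Ly : L = y ^+ 5).

Let y_pow_ge k : 60 ^+ k <= y ^+ k.
Proof. by apply: lerXn2r; rewrite ?nnegrE//; move: y60; lra. Qed.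

Let L_ge : 60 ^+ 5 <= L. Proof. by rewrite Ly y_pow_ge. Qed.

Let order_gt1 : (1 < n)%N.
Proof.
rewrite ltnNge; apply/negP => n1; have := L_ge.
have : L <= 0 by rewrite /L ln_le0// lern1.
lra.
Qed.

Let n0 : 0 < n%:R :> R. Proof. by rewrite ltr0n (ltnW order_gt1). Qed.

Lemma order_ge_cube : L ^+ 3 / 27 <= n%:R.
Proof.
have -> : n%:R = expR L by rewrite lnK.
by apply: expR_ge_cube; move: L_ge; lra.
Qed.

Lemma order_ge_sqr : 8 * L ^+ 2 <= n%:R.
Proof.
apply: le_trans order_ge_cube; rewrite (exprSr L 2) -mulrA [leLHS]mulrC.
apply: ler_wpM2l; first exact: sqr_ge0.
by move: L_ge; lra.
Qed.

Lemma not_source_prob_asymp : n%:R * p < 2 * L - 3 * y ^+ 4 ->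
  ((1 - 5 / L)%:E <= Fnp_prob p (fun g => ~ temporal_source g v))%E.
Proof.
move=> pL; have /andP[p0 p1] := p01.
have LL := L_ge; have L0 : 0 < L by move: LL; lra.
have y4 := y_pow_ge 4; have y3 := y_pow_ge 3.
have nL := order_ge_sqr.
apply: le_trans (not_source_prob_explicit v p01 order_gt1 _ _ _).
- rewrite lee_fin lerD2l lerN2.
  (* The exponent is below [1 - 3 / 2 * y ^+ 4 <= - y ^+ 4], and [expR (y ^+ 4) >= y ^+ 8 / 4]
     exceeds [10 * y ^+ 5]. With [e2], both error terms are then at most [1 / L]. *)
  have e1 : expR (n%:R * p / 2 + 1 - L) <= (10 * L)^-1.
    apply: (@le_trans _ _ (expR (- y ^+ 4))).
      by rewrite ler_expR; move: y4 pL; lra.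
    rewrite expRN lef_pV2 ?posrE ?expR_gt0 ?mulr_gt0//.
    apply: le_trans (expR_ge_sqr _); last by move: y4; lra.
    rewrite Ly -exprM (_ : (4 * 2)%N = (3 + 5)%N)// exprD mulrAC ler_wpM2r//.
      by rewrite exprn_ge0//; move: y60; lra.
    by move: y3; lra.
  have e2 : L / n%:R <= (8 * L)^-1.
    rewrite ler_pdivrMr// mulrC ler_pdivlMr ?mulr_gt0// mulrC.
    by apply: le_trans nL; rewrite expr2 mulrA.
  have -> : 5 / L = 10 * (5 * (10 * L)^-1).
    by field; exact: lt0r_neq0.
  have : (8 * L)^-1 = 10 / 8 * (10 * L)^-1 by field; exact: lt0r_neq0.
  have : 0 <= (10 * L)^-1 by rewrite invr_ge0 mulr_ge0// ltW.
  move: e1 e2; rewrite -/L; move: (expR _) (L / _) ((8 * L)^-1) ((10 * L)^-1).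
  by move=> ? ? ? ?; lra.
- by rewrite -/L; move: LL; lra.
- by apply: le_trans nL; rewrite ler_wpM2r ?sqr_ge0// ler_nat.
- by rewrite -/L; move: y4 pL; lra.
Qed.

Lemma source_prob_asymp : n%:R * p > 2 * L + 3 * y ^+ 4 ->
  ((1 - 5 / L)%:E <= Fnp_prob p (fun g => temporal_source g v))%E.
Proof.
move=> pL; have /andP[p0 p1] := p01.
have LL := L_ge; have L0 : 0 < L by move: LL; lra.
have y60' := y60; have y0 : 0 < y by lra.
have K0 : (0 < n ^ 3)%N by rewrite expn_gt0 (ltnW order_gt1).
apply: le_trans (source_prob_lb v p01 K0).
rewrite lee_fin lerD2l lerN2.
(* With this [s] the margin gains [s * (3 * y ^+ 4)], that is 3/4 of [y ^+ 3], against a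
   second-order loss of about [4 * s ^+ 2 * L], a quarter of [y ^+ 3]. *)
pose s := (4 * y)^-1.
have s0 : 0 <= s <= 1 / 4.
  rewrite invr_ge0 mulr_ge0 ?(ltW y0)//= div1r lef_pV2 ?posrE ?mulr_gt0//.
  lra.
apply: le_trans (spread_fail_le v p01 order_gt1 s0) _.
(* Here [expR (y ^+ 3 / 8) >= y ^+ 6 / 256], which is at least [y ^+ 5 / 5] because
   [y >= 60 > 256 / 5]. *)
apply: (@le_trans _ _ (expR (- (y ^+ 3 / 8)))); last first.
  rewrite expRN -[leLHS]mul1r ler_pdivrMr ?expR_gt0//.
  rewrite mulrAC ler_pdivlMr// mul1r -ler_pdivrMl//.
  apply: le_trans (expR_ge_sqr _); last by rewrite divr_ge0// exprn_ge0// ltW.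
  rewrite Ly -subr_ge0.
  have -> : (y ^+ 3 / 8) ^+ 2 / 4 - 5^-1 * y ^+ 5 = y ^+ 5 * (y / 256 - 5^-1).
    by field.
  by rewrite mulr_ge0 ?exprn_ge0 ?ltW//; lra.
rewrite ler_expR -/L.
have y21 : 0 < 2 * y - 1 by lra.
(* Replaces [(2 * y - 1)^-1] by [(y + 1) / (2 * y ^+ 2)], valid since
   [(y + 1) * (2 * y - 1) >= 2 * y ^+ 2]. *)
apply: (@le_trans _ _ ((1 + y ^+ 5) * ((y + 1) / (2 * y ^+ 2))
    - s * (2 * y ^+ 5 + 3 * y ^+ 4) + s)).
  rewrite lerD2r; apply: lerB.
    have -> : 2 * s * (1 + L) / (1 - 2 * s) = (1 + y ^+ 5) * (2 * y - 1)^-1.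
      rewrite Ly /s; field; apply/andP; split; first exact: lt0r_neq0.
      by rewrite lt0r_neq0//; lra.
    apply: ler_wpM2l; first by rewrite addr_ge0// exprn_ge0// ltW.
    rewrite ler_pdivlMr ?mulr_gt0 ?exprn_gt0// mulrC ler_pdivrMr//.
    by nra.
  rewrite -mulrA ler_wpM2l//; first by case/andP: s0.
  by move: pL; rewrite Ly; lra.
have -> : (1 + y ^+ 5) * ((y + 1) / (2 * y ^+ 2)) -
    s * (2 * y ^+ 5 + 3 * y ^+ 4) + s = (3 * y + 2 - y ^+ 5) / (4 * y ^+ 2).
  by rewrite /s; field; exact: lt0r_neq0.
rewrite ler_pdivrMr ?mulr_gt0 ?exprn_gt0//.
have -> : - (y ^+ 3 / 8) * (4 * y ^+ 2) = - (y ^+ 5 / 2) by field.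
have := y_pow_ge 4; rewrite (exprS y 4) => y4.
nra.
Qed.

End Asymptotics.

(** * The explicit window and the sharp threshold *)

Lemma source_explicit_threshold (R : realType) :
  let eps := fun n : nat => 3 * (ln (n%:R : R)) `^ (8 / 10) / n%:R in
  exists N : nat, forall n : nat, (N <= n)%N ->
    forall p : R, 0 <= p <= 1 -> forall v : 'I_n,
      (p < 2 * ln (n%:R : R) / n%:R - eps n ->
         ((1 - 5 / ln (n%:R : R))%:E <=
            Fnp_prob p (fun g => ~ temporal_source g v))%E) /\
      (p > 2 * ln (n%:R : R) / n%:R + eps n ->
         ((1 - 5 / ln (n%:R : R))%:E <=
            Fnp_prob p (fun g => temporal_source g v))%E).
Proof.
move=> eps; have [N HN] := @ln_natr_ge R (60 ^+ 5).
exists N.+1 => n Nn p p01 v.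
have LL := HN n (ltnW Nn).
have n0 : 0 < n%:R :> R by rewrite ltr0n (leq_trans _ Nn).
have [|y [y0 Ly L8]] := @fifth_root R (ln n%:R).
  by apply: le_trans LL; exact: exprn_ge0.
have y60 : 60 <= y.
  by rewrite -(@ler_pXn2r _ 5) ?nnegrE// -Ly.
rewrite /eps L8; split => [pl|pl].
  apply: (not_source_prob_asymp v p01 y60 Ly).
  by rewrite mulrC -ltr_pdivlMr// mulrBl.
apply: (source_prob_asymp v p01 y60 Ly).
by rewrite [ltRHS]mulrC -ltr_pdivrMr// mulrDl.
Qed.

Lemma cvge1_ln_bound (R : realType) (u : nat -> \bar R) (N : nat) :
  (forall n, (N <= n)%N -> ((1 - 5 / ln n%:R)%:E <= u n <= 1)%E) ->
  u n @[n --> \oo] --> 1%E.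
Proof.
move=> h; apply: (@squeeze_cvge _ _ _ _ (fun n => (1 - 5 / ln n%:R)%:E) _ (fun=> 1%E)).
- by exists N => // n /= /h.
- apply: cvg_EFin; first by near=> n.
  apply/cvgrPdist_le => e e0.
  have [M HM] := @ln_natr_ge R (5 / e).
  exists M => // n /= /HM Ln.
  have L0 : 0 < ln n%:R :> R by apply: lt_le_trans Ln; rewrite divr_gt0.
  rewrite opprB addrC subrK ger0_norm ?divr_ge0 ?(ltW L0)//.
  by rewrite ler_pdivrMr// mulrC -ler_pdivrMr.
- exact: cvg_cst.
Unshelve. all: by end_near. Qed.

Lemma Fnp_prob_le1 (R : realType) n (p : R) (Q : tgraph R 'I_n -> Prop) :
  measurable [set w : sample R n | Q (sample_tgraph w)] -> (Fnp_prob p Q <= 1)%E.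
Proof. exact: probability_le1. Qed.

Lemma source_sharp_threshold (R : realType) (v : forall n : nat, (0 < n)%N -> 'I_n) :
  sharp_threshold (fun n : nat => 2 * ln (n%:R : R) / n%:R) (fixed_source v).
Proof.
move=> e e0; have [N0 HN] := source_explicit_threshold R.
(* The three summands give, in order, [y >= 60], then [3 < e * y], which puts the explicit window
   inside the relative one, and [(1 + e) * (2 * ln n / n) <= 1], so that the upper parameter is a
   probability. *)
have [N1 HN1] := @ln_natr_ge R (60 ^+ 5 + (3 / e) ^+ 5 + 54 * (1 + e)).
have fixedE n (n0 : (0 < n)%N) (g : tgraph R 'I_n) :
    fixed_source v g <-> temporal_source g (v n n0).
  split=> [[n0']|]; last by exists n0.
  by rewrite (bool_irrelevance n0' n0).
have fixedP n (n0 : (0 < n)%N) :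
    @fixed_source R v n = (fun g => temporal_source g (v n n0)).
  by apply/funext => g; apply/propext.
pose N := (maxn N0 N1).+2.
have key n : (N <= n)%N -> exists n0 : (0 < n)%N, [/\ (N0 <= n)%N, 0 < n%:R :> R,
   0 < ln n%:R :> R, 3 * (ln (n%:R : R)) `^ (8 / 10) / n%:R < e * (2 * ln n%:R / n%:R)
   & (1 + e) * (2 * ln (n%:R : R) / n%:R) <= 1].
  move=> Nn; have n2 : (0 < n)%N by apply: leq_trans Nn.
  have N01 : (maxn N0 N1 <= n)%N by apply: leq_trans (ltnW (ltnW Nn)).
  have LL := HN1 n (leq_trans (leq_maxr _ _) N01).
  exists n2; have n0 : 0 < n%:R :> R by rewrite ltr0n.
  have e5 : 0 < (3 / e) ^+ 5 by rewrite exprn_gt0// divr_gt0.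
  have L0 : 0 < ln n%:R :> R by lra.
  have [y [y0 Ly L8]] := fifth_root (ltW L0).
  have y60 : 60 <= y.
    by rewrite -(@ler_pXn2r _ 5) ?nnegrE// -Ly; lra.
  split=> //.
  - exact: leq_trans (leq_maxl _ _) N01.
  - have ye : 3 / e < y.
      by rewrite -(@ltr_pXn2r _ 5) ?nnegrE ?divr_ge0 ?(ltW e0)// -Ly; lra.
    rewrite L8 mulrA ltr_pM2r ?invr_gt0// Ly exprSr.
    have y4 : 0 < y ^+ 4 by rewrite exprn_gt0//; lra.
    move: ye; rewrite ltr_pdivrMr// => ye.
    have := ltr_pM2r y4 3 (y * e); rewrite ye => /esym.
    by move: (y ^+ 4) y4 => z z0; nra.
  - rewrite mulrA ler_pdivrMr// mul1r.
    have := @order_ge_cube R n y y60 Ly; apply: le_trans.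
    have : 54 * (1 + e) <= ln n%:R by lra.
    have : 60 <= ln n%:R :> R by lra.
    by move: (ln n%:R : R) L0 => l l0; nra.
split; apply: (@cvge1_ln_bound R _ N) => n Nn.
- have [n0 [N0n nR0 L0 eL p1]] := key n Nn.
  rewrite (fixedP n n0).
  have mS : measurable [set w : sample R n | ~ temporal_source (sample_tgraph w) (v n n0)].
    by apply: measurableC; exact: temporal_source_measurable.
  rewrite Fnp_prob_le1// andbT.
  set t := 2 * ln n%:R / n%:R in eL p1 *.
  have t0 : 0 <= t by rewrite /t divr_ge0 ?mulr_ge0 ?(ltW L0).
  (* For [e > 1] the lower parameter is negative and outside the explicit statement; the empty graph
     settles this case. *)
  have [pn|pp] := ltP ((1 - e) * t) 0.
    rewrite not_source_negative//; last by apply: leq_trans Nn.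
    by rewrite lee_fin gerBl divr_ge0 ?(ltW L0).
  apply: (HN n N0n _ _ (v n n0)).1; last by rewrite -/t; lra.
  by rewrite pp /=; nra.
- have [n0 [N0n nR0 L0 eL p1]] := key n Nn.
  rewrite (fixedP n n0) Fnp_prob_le1 ?andbT; last exact: temporal_source_measurable.
  set t := 2 * ln n%:R / n%:R in eL p1 *.
  have t0 : 0 <= t by rewrite /t divr_ge0 ?mulr_ge0 ?(ltW L0).
  apply: (HN n N0n _ _ (v n n0)).2; last by rewrite -/t; lra.
  by rewrite p1 andbT; nra.
Qed.

Theorem theorem5p2 (R : realType) :
  (forall v : (forall n : nat, (0 < n)%N -> 'I_n),
     sharp_threshold (fun n : nat => 2 * ln (n%:R : R) / n%:R)
       (fixed_source v)) /\
  let eps := fun n : nat => 3 * (ln (n%:R : R)) `^ (8 / 10) / n%:R in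
  exists N : nat, forall n : nat, (N <= n)%N ->
    forall p : R, 0 <= p <= 1 -> forall v : 'I_n,
      (p < 2 * ln (n%:R : R) / n%:R - eps n ->
         ((1 - 5 / ln (n%:R : R))%:E <=
            Fnp_prob p (fun g => ~ temporal_source g v))%E) /\
      (p > 2 * ln (n%:R : R) / n%:R + eps n ->
         ((1 - 5 / ln (n%:R : R))%:E <=
            Fnp_prob p (fun g => temporal_source g v))%E).
Proof.
by split; [exact: source_sharp_threshold|exact: source_explicit_threshold].
Qed.
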